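(* Let $T$ be a complete first-order theory with infinite models which has $U$-rank one, and let $\mathbb{M}$ be the monster model of $T$. If $(\mathbb{M},\mathbb{P})$ is the monster model of the theory $T_P$ of lovely pairs of $T$, then $e(\mathbb{P})\neq o(\mathbb{P})$.
   Context: Conventions. $T$ is a complete first-order theory in a language $L$ with an infinite model. Fix a strongly inaccessible cardinal $\lambda>|L|$; the monster model of a complete theory is its saturated model of cardinality $\lambda$ (unique up to isomorphism), and ''small'' means of cardinality $<\lambda$. For $\mathbb{D}\subseteq\mathbb{M}$, $(\mathbb{M},\mathbb{D})$ is the expansion of $\mathbb{M}$ by a new predicate interpreted as $\mathbb{D}$, and $o(\mathbb{D})=\{\mathbb{D}'\subseteq\mathbb{M}\mid(\mathbb{M},\mathbb{D})\cong(\mathbb{M},\mathbb{D}')\}=\{f(\mathbb{D})\mid f\in\mathrm{Aut}(\mathbb{M})\}$, $e(\mathbb{D})=\{\mathbb{D}'\subseteq\mathbb{M}\mid(\mathbb{M},\mathbb{D})\equiv(\mathbb{M},\mathbb{D}')\}$. $T$ has $U$-rank one if it is stable and the formula $x=x$ ($x$ a single variable) has Lascar $U$-rank $1$ (so non-algebraic $1$-types have $U$-rank $1$). Such theories are geometric: $\mathrm{acl}$ satisfies exchange in models of $T$ and $T$ eliminates the quantifier $\exists^\infty$. Lovely pairs. Let $T$ be geometric and $L_P=L\cup\{P\}$ with $P$ a new unary predicate. An $L_P$-structure $(M,P(M))$ with $M\models T$ is a lovely pair of $T$ if $P(M)\preceq M$ in $L$ and: (Coheir/density) for every finite $A\subseteq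 M$, every non-algebraic $L$-type $q(x)\in S_1(A)$ has a realization in $P(M)$; (Extension) for every finite $A\subseteq M$, every non-algebraic $L$-type $q(x)\in S_1(A)$ has a realization $a\in M$ with $a\notin\mathrm{acl}(A\cup P(M))$. Here $\mathrm{acl}$ is in the sense of $L$. All lovely pairs of $T$ are elementarily equivalent; their common complete theory is denoted $T_P$ (the theory of lovely pairs of $T$). It is axiomatized by $T$ together with: $P$ is an $L$-elementary substructure; if $\varphi(\bar a,x)$ ($\varphi\in L$) has infinitely many solutions, it has a solution in $P$; if $\varphi(\bar a,x)$ has infinitely many solutions and, for every $\bar y$, $\psi(\bar a,\bar y,x)$ has fewer than $k$ solutions, then some solution $x$ of $\varphi(\bar a,x)$ satisfies $\neg\psi(\bar a,\bar y,x)$ for all $\bar y$ from $P$ ($\varphi,\psi\in L$). Every $\omega$-saturated model of $T_P$ is a lovely pair. The $L$-reduct of the monster model of $T_P$ is identified with $\mathbb{M}$, and $\mathbb{P}=P(\mathbb{M})$. *)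

(* Defs.v *)
From mathcomp Require Import all_boot.
From mathcomp Require Import boolp classical_sets functions cardinality.

Set Implicit Arguments.
Unset Strict Implicit.
Unset Printing Implicit Defensive.

Local Open Scope classical_set_scope.
Local Open Scope card_scope.

(** * Cardinals: a cardinal is represented by a type of that cardinality. *)

Definition card_lt T U (A : set T) (B : set U) : Prop :=
  (A #<= B) /\ ~ (B #<= A).

(** Uncountable, strong limit, and regular: a union of fewer than |K| sets, each
    of cardinality less than |K|, has cardinality less than |K|. *)
Definition strongly_inaccessible (K : Type) : Prop :=
  [/\ card_lt [set: nat] [set: K],
      forall X : set K, card_lt X [set: K] ->
        card_lt [set Y : set K | Y `<=` X] [set: K]
    & forall (I : set K) (F : K -> set K), card_lt I [set: K] ->
        (forall i, I i -> card_lt (F i) [set: K]) ->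
        card_lt (\bigcup_(i in I) F i) [set: K]].

(** * First-order syntax.  [formula L n] is the type of L-formulas whose free
    variables are among n variables, indexed by ['I_n]. *)

Record language := Language {
  funs : Type;
  fun_arity : funs -> nat;
  rels : Type;
  rel_arity : rels -> nat }.
Arguments fun_arity {l}.
Arguments rel_arity {l}.

(** |L| is read as the number of symbols of L; the number of formulas is the
    maximum of this and aleph_0, so either is below an uncountable cardinal if and
    only if the other is. *)
Definition symbols (L : language) : Type := (funs L + rels L)%type.

Inductive term (L : language) (n : nat) : Type :=
| Var of 'I_n
| App (f : funs L) of ('I_(fun_arity f) -> term L n).

(** [All] binds the variable [ord0]; the variable [i] of the ambient context is
    [lift ord0 i] under the binder. *)
Inductive formula (L : language) : nat -> Type :=
| Bot n : formula L n
| Eq n of term L n & term L n : formula L n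
| Rel n (r : rels L) of ('I_(rel_arity r) -> term L n) : formula L n
| Imp n of formula L n & formula L n : formula L n
| All n of formula L n.+1 : formula L n.

Arguments Var {L n}.
Arguments App {L n}.
Arguments Bot {L n}.
Arguments Eq {L n}.
Arguments Rel {L n}.
Arguments Imp {L n}.
Arguments All {L n}.

Definition Neg L n (phi : formula L n) : formula L n := Imp phi Bot.

Definition sentence (L : language) : Type := formula L 0.

(** * Structures and satisfaction. *)

Record structure (L : language) := Structure {
  carrier :> Type;
  fun_interp : forall f : funs L, ('I_(fun_arity f) -> carrier) -> carrier;
  rel_interp : forall r : rels L, ('I_(rel_arity r) -> carrier) -> Prop }.
Arguments fun_interp {L} s f.
Arguments rel_interp {L} s r.

Definition no_tuple {T : Type} : 'I_0 -> T :=
  fun i => False_rect T (notF (ltn_ord i)).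

Definition cons_tuple {T : Type} {n} (x : T) (v : 'I_n -> T) : 'I_n.+1 -> T :=
  fun i => oapp v x (unlift ord0 i).

Definition cat_tuple {T : Type} {n m} (v : 'I_n -> T) (w : 'I_m -> T) :
    'I_(n + m) -> T :=
  fun i => match fintype.split i with inl j => v j | inr j => w j end.

Fixpoint eval L (M : structure L) n (v : 'I_n -> M) (t : term L n) : M :=
  match t with
  | Var i => v i
  | App f ts => fun_interp M f (fun j => eval v (ts j))
  end.

Fixpoint sat L (M : structure L) n (phi : formula L n) : ('I_n -> M) -> Prop :=
  match phi in formula _ n return ('I_n -> M) -> Prop with
  | Bot _ => fun=> False
  | Eq _ s t => fun v => eval v s = eval v t
  | Rel _ r ts => fun v => rel_interp M r (fun j => eval v (ts j))
  | Imp _ phi1 phi2 => fun v => sat phi1 v -> sat phi2 v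
  | All _ phi1 => fun v => forall x : M, sat phi1 (cons_tuple x v)
  end.
Arguments sat {L} M {n}.

Definition holds L (M : structure L) (phi : sentence L) : Prop :=
  sat M phi no_tuple.

Definition models L (T : set (sentence L)) (M : structure L) : Prop :=
  forall phi, T phi -> holds M phi.

Definition entails L (T : set (sentence L)) (phi : sentence L) : Prop :=
  forall M : structure L, models T M -> holds M phi.

Definition complete_theory L (T : set (sentence L)) : Prop :=
  ~ entails T Bot /\ forall phi, entails T phi \/ entails T (Neg phi).

Definition elem_equiv L (M N : structure L) : Prop :=
  forall phi : sentence L, holds M phi <-> holds N phi.

Definition isomorphic L (M N : structure L) : Prop :=
  exists f : M -> N,
    [/\ bijective f,
        forall g (v : 'I_(fun_arity g) -> M),
          f (fun_interp M g v) = fun_interp N g (f \o v)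
      & forall r (v : 'I_(rel_arity r) -> M),
          rel_interp M r v <-> rel_interp N r (f \o v)].

Definition fun_closed L (M : structure L) (P : set M) : Prop :=
  forall f (v : 'I_(fun_arity f) -> M), (forall i, P (v i)) ->
    P (fun_interp M f v).

Definition substructure L (M : structure L) (P : set M) (clP : fun_closed P) :
    structure L :=
  @Structure L {x : M | P x}
    (fun f v => exist P (fun_interp M f (fun i => sval (v i)))
                  (clP f (fun i => sval (v i)) (fun i => svalP (v i))))
    (fun r v => rel_interp M r (fun i => sval (v i))).

Definition elementary_substructure L (M : structure L) (P : set M) : Prop :=
  exists clP : fun_closed P,
    forall n (phi : formula L n) (v : 'I_n -> substructure clP),
      sat (substructure clP) phi v <-> sat M phi (fun i => sval (v i)).

(** * L(M)-formulas phi(x, b) in a single variable x, complete 1-types and acl. *)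

Record pformula L (M : structure L) := PFormula {
  pf_arity : nat;
  pf_formula : formula L pf_arity.+1;
  pf_params : 'I_pf_arity -> M }.

Section Types.
Context (L : language) (M : structure L).
Implicit Types (A B : set M) (phi : pformula M) (p q : set (pformula M)).

Definition over A phi : Prop := forall i, A (pf_params (p := phi) i).

Definition solutions phi : set M :=
  [set x | sat M (pf_formula phi) (cons_tuple x (pf_params (p := phi)))].

Definition pneg phi : pformula M :=
  PFormula (Neg (pf_formula phi)) (pf_params (p := phi)).

Definition closed_pf (phi : formula L 1) : pformula M := PFormula phi no_tuple.

(** p is an element of S_1(A). *)
Definition complete_type A p : Prop :=
  [/\ p `<=` over A,
      forall k (s : 'I_k -> pformula M), (forall i, p (s i)) ->
        exists x, forall i, solutions (s i) x
    & forall phi, over A phi -> p phi \/ p (pneg phi)].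

Definition realizes p (x : M) : Prop := forall phi, p phi -> solutions phi x.

Definition nonalgebraic p : Prop :=
  forall phi, p phi -> infinite_set (solutions phi).

Definition acl A : set M :=
  [set x | exists phi, [/\ over A phi, solutions phi x & finite_set (solutions phi)]].

Definition saturated : Prop :=
  forall A, card_lt A [set: M] ->
    forall p, complete_type A p -> exists x, realizes p x.

(** tp(b/A) = tp(c/A) *)
Definition same_type A n (b c : 'I_n -> M) : Prop :=
  forall m (phi : formula L (n + m)) (a : 'I_m -> M), (forall i, A (a i)) ->
    (sat M phi (cat_tuple b a) <-> sat M phi (cat_tuple c a)).

(** Dividing and forking; meant for M the monster model and A small. *)
Definition divides phi A : Prop :=
  exists (k : nat) (b : nat -> ('I_(pf_arity phi) -> M)),
    (forall i, same_type A (b i) (pf_params (p := phi))) /\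
    (forall s : 'I_k -> nat, injective s ->
       ~ exists x, forall j, sat M (pf_formula phi) (cons_tuple x (b (s j)))).

Definition forks phi A : Prop :=
  exists (m : nat) (psi : 'I_m -> pformula M),
    (forall j, divides (psi j) A) /\
    (forall x, solutions phi x -> exists j, solutions (psi j) x).

Definition type_forks p A : Prop := exists2 phi, p phi & forks phi A.

(** U(p) >= n for p in S_1(A); small sets are those of cardinality < |M|. *)
Fixpoint U_ge (n : nat) A p : Prop :=
  match n with
  | 0 => True
  | n'.+1 => exists B q,
      [/\ card_lt B [set: M], A `<=` B & complete_type B q] /\
      [/\ p `<=` q, type_forks q A & U_ge n' B q]
  end.

(** U(phi) is the supremum of U(p) for p in S_1(set0) containing phi. *)
Definition U_rank (phi : formula L 1) (n : nat) : Prop :=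
  (exists p, [/\ complete_type set0 p, p (closed_pf phi) & U_ge n set0 p]) /\
  (forall p, complete_type set0 p -> p (closed_pf phi) -> ~ U_ge n.+1 set0 p).

End Types.

Definition monster K L (T : set (sentence L)) (M : structure L) : Prop :=
  [/\ models T M, [set: M] #= [set: K] & saturated M].

(** No formula phi(x_0, ..., x_(n-1); y_0, ..., y_(m-1)) has the order property. *)
Definition stable L (T : set (sentence L)) : Prop :=
  forall n m (phi : formula L (n + m)) (M : structure L), models T M ->
    ~ exists (a : nat -> ('I_n -> M)) (b : nat -> ('I_m -> M)),
        forall i j, sat M phi (cat_tuple (a i) (b j)) <-> (i < j)%N.

(** The U-rank is computed in the monster model (of cardinality |K|) of T. *)
Definition U_rank_one K L (T : set (sentence L)) : Prop :=
  stable T /\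
  forall M : structure L, monster K T M ->
    U_rank M (Eq (Var ord0) (Var ord0)) 1.

(** * Pairs.  Every L_P-structure is of the form [expand M P] (with M its L-reduct and
    P the interpretation of the new predicate), so pairs are handled as such. *)

Definition pair_language (L : language) : language :=
  @Language (funs L) (@fun_arity L) (option (rels L))
    (fun r => if r is Some r' then rel_arity r' else 1).

Definition expand L (M : structure L) (P : set M) : structure (pair_language L) :=
  @Structure (pair_language L) M (fun_interp M)
    (fun r => match r return ('I_(@rel_arity (pair_language L) r) -> M) -> Prop with
              | Some r' => fun v => rel_interp M r' v
              | None => fun v => P (v ord0)
              end).
Arguments expand {L}.

Definition lovely_pair L (T : set (sentence L)) (M : structure L) (P : set M) : Prop :=
  [/\ models T M,
      elementary_substructure P,
      forall A q, finite_set A -> complete_type A q -> nonalgebraic q ->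
        exists2 a, P a & realizes q a
    & forall A q, finite_set A -> complete_type A q -> nonalgebraic q ->
        exists2 a, realizes q a & ~ acl (A `|` P) a].
Arguments lovely_pair {L}.

(** T_P, the common theory of the lovely pairs of T. *)
Definition lovely_theory L (T : set (sentence L)) : set (sentence (pair_language L)) :=
  [set phi | forall (M : structure L) (P : set M),
      lovely_pair T M P -> holds (expand M P) phi].

Definition o_class L (M : structure L) (D : set M) : set (set M) :=
  [set D' | isomorphic (expand M D) (expand M D')].

Definition e_class L (M : structure L) (D : set M) : set (set M) :=
  [set D' | elem_equiv (expand M D) (expand M D')].

Arguments o_class {L}.
Arguments e_class {L}.

(* Main.v *)
Require Import Defs.
From mathcomp Require Import all_boot.
From mathcomp Require Import boolp classical_sets functions cardinality filter.
Import Defs.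

(** The predicate of the saturated pair (M, P) has as many elements as M, since otherwise
    P(x) together with all x <> p (p in P) would be omitted. So it is enough to find a lovely pair
    (M, Q) with Q of smaller cardinality: any two lovely pairs are elementarily equivalent by a back
    and forth between finite tuples that are algebraic over their part in P and a set independent
    over P, so that (M, Q) realizes the complete theory T_P.

    In rank one, non-algebraic formulas do not divide over the empty set; this gives the exchange
    property. With stability it also shows that the instances of each formula fall into finitely
    many classes modulo finite sets: otherwise a coheir sequence of an ultrafilter on pairwise
    inequivalent parameters is indiscernible with infinite consecutive differences, and yields
    alternation of unbounded length, hence the order property. If M0 contains representatives of all
    these classes, types over M0 are stationary: elements not algebraic over M0 and A with the same
    type over M0 have the same type over A. Let Q be the algebraic closure of M0 and of a countable
    sequence of realizations, independent over M0, of each non-algebraic type over M0. There is only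
    a small number of such types, and for every finite A some term of each sequence is not algebraic
    over M0 and A, so that Q meets every non-algebraic type over A. *)

Set Implicit Arguments.
Unset Strict Implicit.
Unset Printing Implicit Defensive.

Local Open Scope classical_set_scope.
Local Open Scope card_scope.

(** * Tuples indexed by arbitrary types *)

(** Indexing tuples by arbitrary types replaces arithmetic on indices: [None] is the variable about
    to be bound, and [sumv] keeps variables apart from parameters. *)
Definition ocons (T V : Type) (x : T) (v : V -> T) : option V -> T :=
  fun o => oapp v x o.

Definition sumv (T V W : Type) (v : V -> T) (w : W -> T) : V + W -> T :=
  fun s => match s with inl i => v i | inr j => w j end.

Lemma cons_tuple0 T n (x : T) (v : 'I_n -> T) : cons_tuple x v ord0 = x.
Proof. by rewrite /cons_tuple unlift_none. Qed.

Lemma cons_tuple_lift T n (x : T) (v : 'I_n -> T) i :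
  cons_tuple x v (lift ord0 i) = v i.
Proof. by rewrite /cons_tuple liftK. Qed.

Lemma cons_tuple_comp T U n (g : T -> U) (x : T) (v : 'I_n -> T) :
  g \o cons_tuple x v = cons_tuple (g x) (g \o v).
Proof. by apply/funext => i; rewrite /= /cons_tuple; case: (unlift _ _). Qed.

Lemma no_tupleE T (v : 'I_0 -> T) : v = no_tuple.
Proof. by apply/funext => -[]. Qed.

(** * Uniformly definable families *)

Section Definability.
Context (L : language).

Fixpoint ren_term n m (f : 'I_n -> 'I_m) (t : term L n) : term L m :=
  match t with
  | Var i => Var (f i)
  | App g ts => App g (fun j => ren_term f (ts j))
  end.

Definition ren_lift n m (f : 'I_n -> 'I_m) : 'I_n.+1 -> 'I_m.+1 :=
  cons_tuple ord0 (lift ord0 \o f).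

Fixpoint ren n (phi : formula L n) : forall m, ('I_n -> 'I_m) -> formula L m :=
  match phi in formula _ n return forall m, ('I_n -> 'I_m) -> formula L m with
  | Bot _ => fun m f => Bot
  | Eq _ s t => fun m f => Eq (ren_term f s) (ren_term f t)
  | Rel _ r ts => fun m f => Rel r (fun j => ren_term f (ts j))
  | Imp _ p q => fun m f => Imp (ren p f) (ren q f)
  | All _ p => fun m f => All (ren p (ren_lift f))
  end.

Lemma eval_ren (S : structure L) n m (f : 'I_n -> 'I_m) (t : term L n) v :
  eval v (ren_term f t) = eval (M := S) (v \o f) t.
Proof. by elim: t => //= g ts IH; congr fun_interp; apply/funext => j. Qed.

Lemma sat_ren (S : structure L) n (phi : formula L n) m (f : 'I_n -> 'I_m)
    (v : 'I_m -> S) : sat S (ren phi f) v <-> sat S phi (v \o f).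
Proof.
elim: phi m f v => {n}[n|n s t|n r ts|n p IHp q IHq|n p IH] m f v //=.
- by rewrite !eval_ren.
- by under [X in rel_interp _ _ X]eq_fun do rewrite eval_ren.
- by rewrite IHp IHq.
- split=> H x; have := H x; rewrite IH.
    by congr sat; apply/funext => i; rewrite /ren_lift cons_tuple_comp cons_tuple0;
      congr cons_tuple; apply/funext => j /=; rewrite cons_tuple_lift.
  congr sat; apply/funext => i; rewrite /ren_lift cons_tuple_comp cons_tuple0.
  by congr cons_tuple; apply/funext => j /=; rewrite cons_tuple_lift.
Qed.

(** One formula serves all structures at once, which lets a property pass from one model to another.
    [V] may be infinite, since [f] picks the finitely many coordinates that occur. *)
Definition udef (V : Type) (D : forall S : structure L, set (V -> S)) : Prop :=
  exists n (phi : formula L n) (f : 'I_n -> V),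
    forall (S : structure L) (v : V -> S), D S v <-> sat S phi (v \o f).

Lemma udef_ext V (D D' : forall S : structure L, set (V -> S)) :
  (forall S v, D S v <-> D' S v) -> udef D -> udef D'.
Proof.
by move=> e [n [phi [f H]]]; exists n, phi, f => S v; rewrite -e.
Qed.

Lemma udef_sat V n (phi : formula L n) (f : 'I_n -> V) :
  udef (fun S v => sat S phi (v \o f)).
Proof. by exists n, phi, f. Qed.

Lemma udef_ren V V' (g : V -> V') (D : forall S : structure L, set (V -> S)) :
  udef D -> udef (fun S v => D S (v \o g)).
Proof. by move=> [n [phi [f H]]]; exists n, phi, (g \o f) => S v; rewrite H. Qed.

Lemma udef_bot V : udef (fun S (_ : V -> S) => False).
Proof. by exists 0, Bot, no_tuple. Qed.

Lemma udef_top V : udef (fun S (_ : V -> S) => True).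
Proof. by exists 0, (Imp Bot Bot), no_tuple => S v /=; split. Qed.

Lemma udef_eq V (x y : V) : udef (fun S v => v x = v y).
Proof.
exists 2, (Eq (Var ord0) (Var ord_max)), (cons_tuple x (cons_tuple y no_tuple)).
move=> S v /=; rewrite cons_tuple0.
have -> : ord_max = lift ord0 ord0 :> 'I_2 by apply/val_inj.
by rewrite cons_tuple_lift cons_tuple0.
Qed.

Lemma udef_imp V (D E : forall S : structure L, set (V -> S)) :
  udef D -> udef E -> udef (fun S v => D S v -> E S v).
Proof.
move=> [n [phi [f Df]]] [m [psi [g Eg]]].
exists (n + m), (Imp (ren phi (lshift m)) (ren psi (@rshift n m))), (cat_tuple f g).
move=> S v /=; rewrite !sat_ren Df Eg.
have -> : (v \o cat_tuple f g) \o lshift m = v \o f.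
  by apply/funext => i; rewrite /= /cat_tuple (unsplitK (inl _ i)).
have -> // : (v \o cat_tuple f g) \o @rshift n m = v \o g.
by apply/funext => i; rewrite /= /cat_tuple (unsplitK (inr _ i)).
Qed.

(* If V is empty there is no junk value for the parameters, hence the case distinction. *)
Lemma udef_formula V (D : forall S : structure L, set (option V -> S)) : udef D ->
  exists n (phi : formula L n.+1) (f : 'I_n -> V),
    forall (S : structure L) x v, D S (ocons x v) <-> sat S phi (cons_tuple x (v \o f)).
Proof.
move=> [n [phi [f H]]].
case: (pselect (inhabited V)) => [[v0]|V0].
  exists n, (ren phi (fun i => if f i is Some _ then lift ord0 i else ord0)).
  exists (fun i => odflt v0 (f i)) => S x v.
  rewrite sat_ren H.
  suff -> : ocons x v \o f = cons_tuple x (v \o (fun i => odflt v0 (f i))) \o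
    (fun i => if f i is Some _ then lift ord0 i else ord0) by [].
  apply/funext => i /=; case E: (f i) => [w|] /=; last by rewrite cons_tuple0.
  by rewrite cons_tuple_lift /= E.
exists 0, (ren phi (fun=> ord0)), no_tuple => S x v.
rewrite sat_ren H.
suff -> : ocons x v \o f = cons_tuple x (v \o no_tuple) \o (fun=> ord0) by [].
by apply/funext => i /=; rewrite cons_tuple0; case: (f i) => // w; case: V0.
Qed.

Lemma udef_all V (D : forall S : structure L, set (option V -> S)) :
  udef D -> udef (fun S v => forall x, D S (ocons x v)).
Proof.
move=> /udef_formula[n [phi [f H]]]; exists n, (All phi), f => S v /=.
by split=> h x; apply/H/h.
Qed.

Lemma udef_not V (D : forall S : structure L, set (V -> S)) :
  udef D -> udef (fun S v => ~ D S v).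
Proof. by move=> uD; apply: udef_imp => //; exact: udef_bot. Qed.

Lemma udef_and V (D E : forall S : structure L, set (V -> S)) :
  udef D -> udef E -> udef (fun S v => D S v /\ E S v).
Proof.
move=> uD uE; apply: (@udef_ext _ (fun S v => ~ (D S v -> ~ E S v))).
  move=> S v; split=> [h|[d e h]]; last exact: h.
  by apply: contrapT => dne; apply: h => d e; exact: dne.
by apply: udef_not; apply: udef_imp => //; exact: udef_not.
Qed.

Lemma udef_ex V (D : forall S : structure L, set (option V -> S)) :
  udef D -> udef (fun S v => exists x, D S (ocons x v)).
Proof.
move=> uD; apply: (@udef_ext _ (fun S v => ~ forall x, ~ D S (ocons x v))).
  move=> S v; split=> [h|[x ? h]]; last exact: (h x).
  by apply: contrapT => ne; apply: h => x ?; apply: ne; exists x.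
by apply: udef_not; apply: (@udef_all _ (fun S v => ~ D S v)); exact: udef_not.
Qed.

Lemma udef_forall_fin V (I : finType) (D : I -> forall S : structure L, set (V -> S)) :
  (forall i, udef (D i)) -> udef (fun S v => forall i, D i S v).
Proof.
move=> uD.
suff H (s : seq I) : udef (fun S v => forall i, i \in s -> D i S v).
  apply: udef_ext (H (enum I)) => S v.
  by split=> h i => [|_]; apply: h; rewrite mem_enum.
elim: s => [|i s IH].
  by apply: udef_ext (@udef_top V).
apply: udef_ext (udef_and (uD i) IH) => S v.
split=> [[h1 h2] j|h]; first by rewrite inE => /predU1P[->|/h2].
by split=> [|j js]; apply: h; rewrite inE ?eqxx ?js ?orbT.
Qed.

End Definability.

(** * Counting solutions *)

(** The recursive form is visibly first order, with one existential quantifier for each unit of [k],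
    so that bounds on the size of definable sets are themselves definable. *)
Fixpoint geq_card (T : Type) (k : nat) (E : set T) : Prop :=
  if k is k'.+1 then exists x, E x /\ geq_card k' (E `\ x) else True.

Lemma geq_card_sub T k (E F : set T) : E `<=` F -> geq_card k E -> geq_card k F.
Proof.
elim: k E F => //= k IH E F sEF [x [Ex h]]; exists x; split; first exact: sEF.
by apply: IH h => y [Ey ?]; split; first exact: sEF.
Qed.

Lemma finite_setD1 T (E : set T) x : finite_set (E `\ x) -> finite_set E.
Proof.
move=> h; apply: (@sub_finite_set _ _ ((E `\ x) `|` [set x])).
  by move=> y Ey; have [->|yx] := pselect (y = x); [right|left].
by rewrite finite_setU; split=> //; exact: finite_set1.
Qed.

Lemma geq_card_infinite T k (E : set T) : infinite_set E -> geq_card k E.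
Proof.
elim: k E => //= k IH E iE; have [x Ex] := infinite_setN0 iE.
by exists x; split=> //; apply: IH => h; exact/iE/(finite_setD1 h).
Qed.

Lemma ngeq_card_finite T k (E : set T) : ~ geq_card k E -> finite_set E.
Proof. by move=> h; apply: contrapT => /(@geq_card_infinite _ k). Qed.

Lemma geq_card_seq (T : eqType) k (E : set T) (s : seq T) :
  (forall x, E x -> x \in s) -> geq_card k E -> (k <= size s)%N.
Proof.
elim: k E s => //= k IH E s sE [x [Ex h]].
have xs := sE x Ex; rewrite (perm_size (perm_to_rem xs)) /= ltnS.
apply: IH h => y [Ey nyx]; have := sE y Ey; have /eqP yx : y <> x by [].
by rewrite (perm_mem (perm_to_rem xs)) inE (negbTE yx).
Qed.

Lemma finite_ngeq_card T (E : set T) : finite_set E -> exists k, ~ geq_card k E.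
Proof.
move=> fE; have /finite_seqP[s es] : @finite_set {classic T} E := fE.
exists (size s).+1 => h.
have : ((size s).+1 <= size s)%N; last by rewrite ltnn.
by apply: (@geq_card_seq {classic T} _ E) h => x; rewrite es.
Qed.

Lemma infinite_geq_card T (E : set T) : infinite_set E <-> forall k, geq_card k E.
Proof.
split=> [iE k|h fE]; first exact: geq_card_infinite.
by have [k] := finite_ngeq_card fE; apply.
Qed.

Lemma geq_card_inj T k (s : 'I_k -> T) (E : set T) :
  injective s -> (forall i, E (s i)) -> geq_card k E.
Proof.
elim: k s E => //= k IH s E inj h; exists (s ord0); split=> //.
apply: (IH (s \o lift ord0)); first exact: inj_comp inj (@lift_inj _ _).
by move=> i; split=> //= /inj /eqP; rewrite eq_sym (negbTE (neq_lift _ _)).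
Qed.

Lemma udef_geq_card L V k (D : forall S : structure L, set (option V -> S)) :
  udef D -> udef (fun S v => geq_card k [set x | D S (ocons x v)]).
Proof.
elim: k V D => [|k IH] V D uD /=.
  exact: udef_top.
(* Here [Some None] is the element already removed, now a parameter, and [None] is the element being
   counted. *)
pose D' (S : structure L) (w : option (option V) -> S) :=
  D S (fun o => w (omap Some o)) /\ w None <> w (Some None).
have uD' : udef D'.
  apply: udef_and; first exact: (udef_ren (omap Some) uD).
  by apply: udef_not; exact: udef_eq.
apply: (@udef_ext _ _ (fun S v => exists x, D S (ocons x v) /\
    geq_card k [set y | D' S (ocons y (ocons x v))])); last first.
  apply: (@udef_ex _ _ (fun S w => D S w /\ geq_card k [set y | D' S (ocons y w)])).
  by apply: udef_and => //; exact: (IH _ _ uD').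
move=> S v.
have e x : [set y | D' S (ocons y (ocons x v))] = [set y | D S (ocons y v)] `\ x.
  apply/seteqP; split=> y [h1 h2]; split=> //; move: h1; congr D;
  by apply/funext => -[].
by split=> -[x [h1 h2]]; exists x; split=> //; move: h2; rewrite e.
Qed.

(** * Sets definable with parameters, and algebraic closure *)

Section Definable.
Context (L : language) (M : structure L).
Implicit Types (A B : set M).

(** [W] may list any number of parameters at once: only finitely many of them occur in a uniformly
    definable [D]. *)
Definition dfn A (V : Type) (E : set (V -> M)) : Prop :=
  exists (W : Type) (D : forall S : structure L, set (V + W -> S)) (b : W -> M),
    [/\ udef D, forall w, A (b w) & forall v, E v <-> D M (sumv v b)].

Lemma dfn_ext A V (E E' : set (V -> M)) : (forall v, E v <-> E' v) -> dfn A E -> dfn A E'.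
Proof.
by move=> e [W [D [b [uD Ab H]]]]; exists W, D, b; split=> // v; rewrite -e.
Qed.

Lemma dfn_mono A B V (E : set (V -> M)) : A `<=` B -> dfn A E -> dfn B E.
Proof. by move=> sAB [W [D [b [uD Ab H]]]]; exists W, D, b; split=> // w; exact: sAB. Qed.

Lemma dfn_udef A V (D : forall S : structure L, set (V -> S)) : udef D -> dfn A (D M).
Proof.
move=> uD; exists 'I_0, (fun S v => D S (v \o inl)), no_tuple; split=> [||v].
- exact: udef_ren.
- by case.
- by [].
Qed.

Lemma dfn_fix A V W (E : set (V + W -> M)) (b : W -> M) :
  (forall w, A (b w)) -> dfn A E -> dfn A (fun v => E (sumv v b)).
Proof.
move=> Ab [W' [D [b' [uD Ab' H]]]].
pose g (s : V + W + W') : V + (W + W') :=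
  match s with inl (inl v) => inl v | inl (inr w) => inr (inl w) | inr w => inr (inr w) end.
exists (W + W')%type, (fun S v => D S (v \o g)), (sumv b b').
split=> [|[]//|v]; first exact: udef_ren.
rewrite H; suff -> : sumv (sumv v b) b' = sumv v (sumv b b') \o g by [].
by apply/funext => -[[]|].
Qed.

Lemma dfn_ren A V V' (g : V -> V') (E : set (V -> M)) :
  dfn A E -> dfn A (fun v => E (v \o g)).
Proof.
move=> [W [D [b [uD Ab H]]]].
pose h (s : V + W) : V' + W := match s with inl v => inl (g v) | inr w => inr w end.
exists W, (fun S v => D S (v \o h)), b; split=> [|//|v]; first exact: udef_ren.
by rewrite H; suff -> : sumv (v \o g) b = sumv v b \o h by []; apply/funext => -[].
Qed.

Lemma dfn_bot A V : dfn A (fun _ : V -> M => False).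
Proof. exact: (dfn_udef A (@udef_bot L V)). Qed.

Lemma dfn_top A V : dfn A (fun _ : V -> M => True).
Proof.
by apply: (dfn_udef A (D := fun S v => True)); exact: udef_top.
Qed.

Lemma dfn_const A V (Q : Prop) : dfn A (fun _ : V -> M => Q).
Proof.
have [q|nq] := pselect Q; first by apply: dfn_ext (dfn_top A V) => v; split.
by apply: dfn_ext (dfn_bot A V) => v; split.
Qed.

Lemma dfn_eq A V (x y : V) : dfn A (fun v : V -> M => v x = v y).
Proof. exact: (dfn_udef A (udef_eq L x y)). Qed.

Lemma dfn_imp A V (E F : set (V -> M)) : dfn A E -> dfn A F -> dfn A (fun v => E v -> F v).
Proof.
move=> [W [D [b [uD Ab H]]]] [W' [D' [b' [uD' Ab' H']]]].
pose g (s : V + W) : V + (W + W') := match s with inl v => inl v | inr w => inr (inl w) end.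
pose g' (s : V + W') : V + (W + W') := match s with inl v => inl v | inr w => inr (inr w) end.
exists (W + W')%type, (fun S v => D S (v \o g) -> D' S (v \o g')), (sumv b b').
split=> [|[]//|v]; first by apply: udef_imp; exact: udef_ren.
rewrite H H'; suff [-> ->] : sumv v b = sumv v (sumv b b') \o g /\
   sumv v b' = sumv v (sumv b b') \o g' by [].
by split; apply/funext => -[].
Qed.

Lemma dfn_all A V (E : set (option V -> M)) :
  dfn A E -> dfn A (fun v => forall x, E (ocons x v)).
Proof.
move=> [W [D [b [uD Ab H]]]].
pose g (s : option V + W) : option (V + W) :=
  match s with inl None => None | inl (Some v) => Some (inl v) | inr w => Some (inr w) end.
exists W, (fun S v => forall x, D S (ocons x v \o g)), b.
split=> // [|v].
  by apply: (@udef_all _ _ (fun S v => D S (v \o g))); exact: udef_ren.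
have e x : sumv (ocons x v) b = ocons x (sumv v b) \o g by apply/funext => -[[]|].
by split=> h x; [rewrite -e -H|rewrite H e].
Qed.

Lemma dfn_not A V (E : set (V -> M)) : dfn A E -> dfn A (fun v => ~ E v).
Proof. by move=> dE; apply: dfn_imp => //; exact: dfn_bot. Qed.

Lemma dfn_and A V (E F : set (V -> M)) : dfn A E -> dfn A F -> dfn A (fun v => E v /\ F v).
Proof.
move=> dE dF; apply: (@dfn_ext _ _ (fun v => ~ (E v -> ~ F v))).
  move=> v; split=> [h|[d e h]]; last exact: h.
  by apply: contrapT => dne; apply: h => d e; exact: dne.
by apply: dfn_not; apply: dfn_imp => //; exact: dfn_not.
Qed.

Lemma dfn_or A V (E F : set (V -> M)) : dfn A E -> dfn A F -> dfn A (fun v => E v \/ F v).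
Proof.
move=> dE dF; apply: (@dfn_ext _ _ (fun v => ~ E v -> F v)).
  by move=> v; have := EM (E v); tauto.
by apply: dfn_imp => //; exact: dfn_not.
Qed.

Lemma dfn_iff A V (E F : set (V -> M)) : dfn A E -> dfn A F -> dfn A (fun v => E v <-> F v).
Proof. by move=> dE dF; apply: dfn_and; apply: dfn_imp. Qed.

Lemma dfn_ex A V (E : set (option V -> M)) :
  dfn A E -> dfn A (fun v => exists x, E (ocons x v)).
Proof.
move=> dE; apply: (@dfn_ext _ _ (fun v => ~ forall x, ~ E (ocons x v))).
  move=> v; split=> [h|[x ? h]]; last exact: (h x).
  by apply: contrapT => ne; apply: h => x ?; apply: ne; exists x.
by apply: dfn_not; apply: (@dfn_all _ _ (fun v => ~ E v)); exact: dfn_not.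
Qed.

Lemma dfn_geq_card A V k (E : set (option V -> M)) :
  dfn A E -> dfn A (fun v => geq_card k [set x | E (ocons x v)]).
Proof.
move=> [W [D [b [uD Ab H]]]].
pose g (s : option V + W) : option (V + W) :=
  match s with inl None => None | inl (Some v) => Some (inl v) | inr w => Some (inr w) end.
exists W, (fun S v => geq_card k [set x | D S (ocons x v \o g)]), b.
split=> // [|v].
  by apply: (@udef_geq_card _ _ k (fun S v => D S (v \o g))); exact: udef_ren.
suff -> : [set x | E (ocons x v)] = [set x | D M (ocons x (sumv v b) \o g)] by [].
have e x : sumv (ocons x v) b = ocons x (sumv v b) \o g by apply/funext => -[[]|].
by apply/seteqP; split=> x /=; rewrite H e.
Qed.

Lemma dfn_forall_fin A V (I : finType) (E : I -> set (V -> M)) :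
  (forall i, dfn A (E i)) -> dfn A (fun v => forall i, E i v).
Proof.
move=> dE.
suff H (s : seq I) : dfn A (fun v => forall i, i \in s -> E i v).
  apply: dfn_ext (H (enum I)) => v.
  by split=> h i => [|_]; apply: h; rewrite mem_enum.
elim: s => [|i s IH].
  by apply: dfn_ext (dfn_top A V).
apply: dfn_ext (dfn_and (dE i) IH) => v.
split=> [[h1 h2] j|h]; first by rewrite inE => /predU1P[->|/h2].
by split=> [|j js]; apply: h; rewrite inE ?eqxx ?js ?orbT.
Qed.

Definition dfn1 A (E : set M) : Prop := dfn A (fun v : unit -> M => E (v tt)).

Lemma dfn1_slice A V (E : set (option V -> M)) (v : V -> M) :
  (forall i, A (v i)) -> dfn A E -> dfn1 A [set x | E (ocons x v)].
Proof.
move=> Av dE.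
pose g (o : option V) : unit + V := if o is Some i then inr i else inl tt.
have /(dfn_fix Av) := @dfn_ren _ _ (unit + V)%type g E dE.
apply: dfn_ext => w; suff -> : sumv w v \o g = ocons (w tt) v by [].
by apply/funext => -[].
Qed.

Lemma dfn1_formula A (E : set M) :
  dfn1 A E <-> exists2 phi : pformula M, over A phi & solutions phi = E.
Proof.
split=> [[W [D [b [uD Ab H]]]]|[[n phi b] Ab <-]].
  pose g (s : unit + W) : option W := if s is inr w then Some w else None.
  have [n [phi [f Hf]]] := udef_formula (udef_ren g uD).
  exists (PFormula phi (b \o f)); first by move=> i; exact: Ab.
  apply/seteqP; split=> x; rewrite /solutions /= -Hf => h.
    apply/(H (fun=> x)); suff <- : ocons x b \o g = sumv (fun=> x) b by [].
    by apply/funext => -[[]|].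
  have /H : E ((fun=> x) tt) by []; suff -> : ocons x b \o g = sumv (fun=> x) b by [].
  by apply/funext => -[[]|].
pose F (w : option 'I_n -> M) := sat M phi (w \o cons_tuple None Some).
have -> : solutions (PFormula phi b) = [set x | F (ocons x b)].
  by apply/seteqP; split=> x; rewrite /F /= cons_tuple_comp.
apply: dfn1_slice => //.
exact: (dfn_udef A (udef_sat phi (cons_tuple None Some))).
Qed.

Lemma dfn1_not A (E : set M) : dfn1 A E -> dfn1 A (~` E).
Proof. exact: dfn_not. Qed.

Lemma dfn1_and A (E F : set M) : dfn1 A E -> dfn1 A F -> dfn1 A (E `&` F).
Proof. exact: dfn_and. Qed.

Lemma dfn1_or A (E F : set M) : dfn1 A E -> dfn1 A F -> dfn1 A (E `|` F).
Proof. exact: dfn_or. Qed.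

Lemma dfn1_top A : dfn1 A setT.
Proof. exact: dfn_top. Qed.

Lemma dfn1_mono A B (E : set M) : A `<=` B -> dfn1 A E -> dfn1 B E.
Proof. exact: dfn_mono. Qed.

Lemma dfn1_point A a : A a -> dfn1 A [set a].
Proof.
move=> Aa; apply: (@dfn1_slice _ unit (fun v => v None = v (Some tt)) (fun=> a)) => //.
exact: dfn_eq.
Qed.

Lemma aclP A x : acl A x <-> exists E, [/\ dfn1 A E, E x & finite_set E].
Proof.
split=> [[phi [oA sx fin]]|[E [/dfn1_formula[phi oA <-] ? ?]]]; last by exists phi.
by exists (solutions phi); split=> //; apply/dfn1_formula; exists phi.
Qed.

Lemma acl_incl A : A `<=` acl A.
Proof.
move=> a Aa; apply/aclP; exists [set a]; split=> //; exact: dfn1_point.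
Qed.

Lemma acl_mono A B : A `<=` B -> acl A `<=` acl B.
Proof.
move=> sAB x /aclP[E [dE Ex fE]]; apply/aclP; exists E; split=> //; exact: dfn1_mono dE.
Qed.

(** Separates the parameters: those in [A] stay fixed inside [G], those from [c] become variables,
    so that the set can be moved by changing [c]. *)
Lemma dfn1_param A V (c : V -> M) (E : set M) : dfn1 (A `|` range c) E ->
  exists G : set (option V -> M), dfn A G /\ E = [set x | G (ocons x c)].
Proof.
move=> [W [D [b [uD Ab H]]]].
pose W' := {w | A (b w)}.
have /choice[h hP] (w : W) : exists s : V + W', b w = sumv c (fun w' : W' => b (sval w')) s.
  have [Aw|[v _ <-]] := Ab w; last by exists (inl v).
  by exists (inr (exist _ w Aw)).
pose g (s : unit + W) : option V + W' :=
  match s with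
  | inl _ => inl None
  | inr w => match h w with inl v => inl (Some v) | inr w' => inr w' end
  end.
exists (fun v => D M (sumv v (fun w' : W' => b (sval w')) \o g)); split.
  apply: (@dfn_fix _ _ _ (fun v => D M (v \o g)) (fun w' : W' => b (sval w'))); first by case.
  exact: (dfn_udef A (udef_ren g uD)).
apply/seteqP; split=> x /=.
  move=> Ex; have /H : E ((fun=> x) tt) by []; congr (D M).
  by apply/funext => -[[]|w] //=; rewrite hP; case: (h w).
move=> Dx; apply/(H (fun=> x)); move: Dx; congr (D M).
by apply/funext => -[[]|w] //=; rewrite hP; case: (h w).
Qed.

(** The fibre over [b] has fewer than [k] elements. Keeping only those [y] of the finite set [F]
    whose fibres are equally small gives a finite union of finite sets, still definable over [A]. *)
Lemma acl_acl1 A b x : acl A b -> acl (A `|` [set b]) x -> acl A x.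
Proof.
move=> /aclP[F [dF Fb fF]] /aclP[E [dE Ex /finite_ngeq_card[k Ek]]].
have /dfn1_param[G [dG eE]] : dfn1 (A `|` range (fun _ : unit => b)) E.
  by apply: dfn1_mono dE => y [|->]; [left|right; exists tt].
pose E' y := [set z | G (ocons z (fun=> y))].
have bnd y : F y /\ ~ geq_card k (E' y) -> finite_set (E' y).
  by case=> _; exact: ngeq_card_finite.
apply/aclP; exists (\bigcup_(y in [set y | F y /\ ~ geq_card k (E' y)]) E' y); split.
- pose H (w : option unit -> M) := [/\ F (w None),
    ~ geq_card k [set z | G (ocons z (fun _ : unit => w None))] &
    G (ocons (w (Some tt)) (fun=> w None))].
  apply: (@dfn_ext _ _ (fun v : unit -> M => exists y, H (ocons y v))).
    by move=> v; split=> [[y [? ? ?]]|[y [? ?] ?]]; exists y.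
  apply: dfn_ex; apply: (@dfn_ext _ _ (fun w => F (w None) /\
     (~ geq_card k [set z | G (ocons z (fun _ : unit => w None))] /\
      G (ocons (w (Some tt)) (fun=> w None))))).
    by move=> w; split=> [[? []]|[]].
  apply: dfn_and.
    exact: (@dfn_ren _ _ _ (fun _ : unit => None) (fun v => F (v tt)) dF).
  apply: dfn_and.
    apply: dfn_not.
    exact: (@dfn_ren _ _ _ (fun _ : unit => None : option unit) _ (dfn_geq_card k dG)).
  pose g (o : option unit) : option unit := if o is None then Some tt else None.
  have := @dfn_ren _ _ _ g _ dG; apply: dfn_ext => v.
  by suff -> : v \o g = ocons (v (Some tt)) (fun=> v None) by []; apply/funext => -[].
- exists b; first by split=> //; rewrite /E' -eE.
  by rewrite /E' -eE.
- apply: bigcup_finite => [|y yP]; last exact: bnd.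
  by apply: sub_finite_set fF => y [].
Qed.

Lemma acl_finite A x : acl A x -> exists (k : nat) (a : 'I_k -> M),
  (forall i, A (a i)) /\ acl (range a) x.
Proof.
move=> [phi [oA sx fin]]; exists (pf_arity phi), (pf_params (p := phi)); split=> //.
by exists phi; split=> // i; exists i.
Qed.

Lemma acl_trans A B x : B `<=` acl A -> acl B x -> acl A x.
Proof.
move=> sBA /acl_finite[k [a [Ba]]].
have {Ba sBA} : forall i, acl A (a i) by move=> i; exact/sBA.
move=> Aa ax.
suff H (s : seq 'I_k) : acl (A `|` [set a i | i in [set` s]]) x -> acl A x.
  apply: (H (enum 'I_k)); apply: acl_mono ax => _ [i _ <-]; right; exists i => //=.
  by rewrite mem_enum.
elim: s => [|i s IH].
  by apply: acl_mono => y [//|[i]].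
move=> h; apply: IH; apply: (@acl_acl1 _ (a i)).
  by apply: acl_mono (Aa i) => y; left.
apply: acl_mono h => y [|[j /=]]; first by left; left.
by rewrite inE => /predU1P[-> <-|js <-]; [right|left; right; exists j].
Qed.

End Definable.

(** * Cardinal arithmetic below an inaccessible *)

Lemma card_le_injP (T U : Type) :
  [set: T] #<= [set: U] <-> exists f : T -> U, injective f.
Proof.
split=> [/card_leP[f]|[f fi]].
  have mT (x : T) : x \in [set: T] by rewrite in_setT.
  exists (fun x => set_val (f (SigSub (mT x)))) => x y /val_inj /(@inj _ _ _ f).
  by rewrite !in_setT => /(_ isT isT)/(congr1 set_val).
have [g] : $|{injfun [set: T] >-> [set: U]}| by apply/injfunPex; exists f => // x y _ _ /fi.
exact: inj_card_le.
Qed.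

Lemma card_le_total (T U : Type) : [set: T] #<= [set: U] \/ [set: U] #<= [set: T].
Proof.
pose P (R : set (T * U)) := forall p q, R p -> R q -> (p.1 = q.1) <-> (p.2 = q.2).
have [F FP tF|R [PR Rmax]] := @Zorn_bigcup (T * U)%type P.
  move=> p q [A FA Ap] [B FB Bq]; have [sAB|sBA] := tF _ _ FA FB.
    by apply: (FP _ FB) => //; exact: sAB.
  by apply: (FP _ FA) => //; exact: sBA.
have [dom|/existsNP[x xR]] := pselect (forall x, exists y, R (x, y)).
  left; have /choice[f fR] := dom.
  apply/card_le_injP; exists f => x y e.
  by have [_] := PR _ _ (fR x) (fR y); apply.
have [cod|/existsNP[y yR]] := pselect (forall y, exists x, R (x, y)).
  right; have /choice[f fR] := cod.
  apply/card_le_injP; exists f => a b e.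
  by have [+ _] := PR _ _ (fR a) (fR b); apply.
exfalso; apply: (Rmax (R `|` [set (x, y)])).
  split; first by move=> p; left.
  by move=> /(_ (x, y)) h; apply: xR; exists y; apply: h; right.
move=> [a b] [a' b'] [Rp|[-> ->]] [Rq|[-> ->]] //=; first exact: (PR _ _ Rp Rq).
  by split=> e; subst; [case: xR; exists b|case: yR; exists a].
by split=> e; subst; [case: xR; exists b'|case: yR; exists a'].
Qed.

Section Small.
Context (K : Type) (inaccK : strongly_inaccessible K).

Definition small (T : Type) : Prop := card_lt [set: T] [set: K].

Lemma card_lt_le T U (A : set T) (B : set U) :
  A #<= B -> card_lt B [set: K] -> card_lt A [set: K].
Proof.
move=> AB [BK KB]; split; first exact: card_le_trans BK.
by move=> KA; apply: KB; exact: card_le_trans AB.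
Qed.

Lemma card_ltP T : small T <-> ~ ([set: K] #<= [set: T]).
Proof. by split=> [[]//|nKT]; split=> //; have [|//] := card_le_total K T. Qed.

Lemma card_lt_set_type T (A : set T) : small A <-> card_lt A [set: K].
Proof.
by have := card_setT A; rewrite card_eq_le => /andP[? ?]; split; apply: card_lt_le.
Qed.

Lemma small_inj T U (f : T -> U) : injective f -> small U -> small T.
Proof. by move=> fi; apply: card_lt_le; apply/card_le_injP; exists f. Qed.

Lemma small_image T U (f : T -> U) : small T -> card_lt (range f) [set: K].
Proof. by apply: card_lt_le; exact: card_image_le. Qed.

(** This is regularity: an injection [h] of [K] into the sum would cover [K] by the fibres of
    [projT1 \o h], a small number of sets that embed into the small [F i]. *)
Lemma small_sigma (I : Type) (F : I -> Type) :
  small I -> (forall i, small (F i)) -> small {i & F i}.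
Proof.
move=> sI sF; apply/card_ltP => /card_le_injP[h hi].
have [_ _ reg] := inaccK.
have [/card_le_injP[e ei] _] := sI.
have /reg : card_lt (range e) [set: K] by exact: small_image.
move=> /(_ (fun k => [set x | e (projT1 (h x)) = k])) [].
  move=> _ [i _ <-]; apply: card_lt_le (sF i).
  apply: (@card_le_trans _ _ _ (range (fun y : F i => existT F i y))); last exact: card_image_le.
  have := @inj_card_eq _ _ [set x | e (projT1 (h x)) = e i] h (in2W hi).
  rewrite card_eq_le => /andP[_ hle]; apply: card_le_trans hle _.
  apply: subset_card_le => _ [x /= /ei xi <-]; move: xi; case: (h x) => j y /= ji.
  by case: _ / ji; exists y.
move=> _; apply.
by apply: subset_card_le => x _; exists (e (projT1 (h x))) => //; exists (projT1 (h x)).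
Qed.

Lemma small_powerset T : small T -> small (set T).
Proof.
move=> sT; have [_ lim _] := inaccK; have [/card_le_injP[e ei] _] := sT.
apply: card_lt_le (lim _ (small_image e sT)).
have [g] : $|{injfun [set: set T] >-> [set Y | Y `<=` range e]}|; last exact: inj_card_le.
apply/injfunPex; exists (fun A => e @` A); first by move=> A _ _ [x _ <-]; exists x.
move=> A B _ _ /= AB; apply/seteqP; split=> x Ax.
  have : (e @` B) (e x) by rewrite -AB; exists x.
  by case=> y By /ei <-.
have : (e @` A) (e x) by rewrite AB; exists x.
by case=> y By /ei <-.
Qed.

Lemma small_countable (T : countType) : small T.
Proof.
have [natK _ _] := inaccK; apply: card_lt_le natK.
by apply/card_le_injP; exists pickle; exact: (pcan_inj pickleK).
Qed.

Lemma small_prod T U : small T -> small U -> small (T * U).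
Proof.
move=> sT sU; have sTU := @small_sigma T (fun=> U) sT (fun=> sU).
apply: (@small_inj _ _ (fun p : T * U => existT (fun=> U) p.1 p.2) _ sTU).
move=> [a b] [c d] /= h.
exact: (congr1 (fun s : {_ : T & U} => (projT1 s, projT2 s)) h).
Qed.

Lemma small_fun T U : small T -> small U -> small (T -> U).
Proof.
move=> sT sU; have sP := small_powerset (small_prod sT sU).
apply: (@small_inj _ _ (fun f : T -> U => [set p : T * U | p.2 = f p.1]) _ sP).
move=> f g e; apply/funext => x.
have : [set p : T * U | p.2 = f p.1] (x, f x) by [].
by rewrite e.
Qed.

Lemma card_lt_sub T (A B : set T) : A `<=` B -> card_lt B [set: K] -> card_lt A [set: K].
Proof. by move=> sAB; apply: card_lt_le; exact: subset_card_le. Qed.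

Lemma card_lt_bigcup (I : Type) T (F : I -> set T) : small I ->
  (forall i, card_lt (F i) [set: K]) -> card_lt (\bigcup_i F i) [set: K].
Proof.
move=> sI sF; pose f (s : {i & F i}) : T := set_val (projT2 s).
apply: (@card_lt_sub _ _ (range f)).
  by move=> x [i _ /mem_set Fx]; exists (existT _ i (SigSub Fx)).
by apply: small_image; apply: small_sigma => // i; exact/card_lt_set_type.
Qed.

Lemma card_lt_setU T (A B : set T) :
  card_lt A [set: K] -> card_lt B [set: K] -> card_lt (A `|` B) [set: K].
Proof.
move=> sA sB.
apply: card_lt_sub (@card_lt_bigcup bool _ (fun b => if b then A else B) (small_countable _) _).
  by move=> x [Ax|Bx]; [exists true|exists false].
by case.
Qed.

Lemma finite_card_lt T (A : set T) : finite_set A -> card_lt A [set: K].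
Proof.
move=> /finite_set_countable cA; have [natK _ _] := inaccK; exact: card_lt_le natK.
Qed.

(** * Counting terms and formulas *)

Section Language.
Context (L : language) (smallL : small (symbols L)).

Lemma small_funs : small (funs L).
Proof. by apply: (@small_inj _ _ inl _ smallL) => x y []. Qed.

Lemma small_rels : small (rels L).
Proof. by apply: (@small_inj _ _ inr _ smallL) => x y []. Qed.

Fixpoint term_depth n (t : term L n) : nat :=
  match t with
  | Var _ => 0
  | App f ts => (\max_(j < fun_arity f) term_depth (ts j)).+1
  end.

Lemma small_term n : small (term L n).
Proof.
have H d : card_lt [set t : term L n | (term_depth t <= d)%N] [set: K].
  elim: d => [|d IH].
    apply: card_lt_sub (small_image (@Var L n) (small_countable _)) => -[i|//] _.
    by exists i.
  have /card_lt_set_type sd := IH.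
  pose g (s : {f : funs L & 'I_(fun_arity f) -> [set t : term L n | (term_depth t <= d)%N]}) :=
    App (projT1 s) (fun j => set_val (projT2 s j)).
  apply: (@card_lt_sub _ _ (range (@Var L n) `|` range g)).
    case=> [i _|f ts /= h]; first by left; exists i.
    have ht j : ts j \in [set t : term L n | (term_depth t <= d)%N].
      apply/mem_set; apply: leq_trans (h : (_ <= d)%N).
      exact: (leq_bigmax (F := fun j => term_depth (ts j)) j).
    by right; exists (existT _ f (fun j => SigSub (ht j))).
  apply: card_lt_setU; apply: small_image; first exact: small_countable.
  by apply: small_sigma small_funs _ => f; exact: small_fun (small_countable _) sd.
apply: card_lt_sub (card_lt_bigcup (small_countable nat) H) => t _.
by exists (term_depth t) => //=.
Qed.

Fixpoint depth n (phi : formula L n) : nat :=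
  match phi with
  | Bot _ | Eq _ _ _ | Rel _ _ _ => 0
  | Imp _ p q => (maxn (depth p) (depth q)).+1
  | All _ p => (depth p).+1
  end.

(** By induction on depth, as for terms. All numbers of variables are treated together because [All]
    raises that number. *)
Lemma small_formula n : small (formula L n).
Proof.
have H0 m : card_lt [set p : formula L m | (depth p <= 0)%N] [set: K].
  apply: (@card_lt_sub _ _ ([set Bot] `|` (range (fun s : term L m * term L m => Eq s.1 s.2) `|`
    range (fun s : {r : rels L & 'I_(rel_arity r) -> term L m} => Rel (projT1 s) (projT2 s))))).
    case=> {m}//= m; first by left.
      by move=> s t _; right; left; exists (s, t).
    by move=> r ts _; right; right; exists (existT _ r ts).
  apply: card_lt_setU; first by apply: finite_card_lt; exact: finite_set1.
  apply: card_lt_setU; apply: small_image; first by apply: small_prod; exact: small_term.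
  apply: small_sigma small_rels _ => r; apply: small_fun (small_countable _) _.
  exact: small_term.
have H d m : card_lt [set p : formula L m | (depth p <= d)%N] [set: K].
  elim: d m => // d IH m.
  have /card_lt_set_type sm := IH m; have /card_lt_set_type sm' := IH m.+1.
  pose F m := [set p : formula L m | (depth p <= d)%N].
  apply: (@card_lt_sub _ _ ([set p : formula L m | (depth p <= 0)%N] `|`
     (range (fun s : F m * F m => Imp (set_val s.1) (set_val s.2)) `|`
      range (fun p : F m.+1 => All (set_val p))))).
    case=> {m sm sm'}; try by move=> *; left.
      move=> m p q /=; rewrite ltnS geq_max => /andP[hp hq].
      have {}hp : p \in F m by exact/mem_set.
      have {}hq : q \in F m by exact/mem_set.
      by right; left; exists (SigSub hp, SigSub hq).
    move=> m p /= hp; have {}hp : p \in F m.+1 by exact/mem_set.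
    by right; right; exists (SigSub hp).
  apply: card_lt_setU; first exact: H0.
  by apply: card_lt_setU; apply: small_image => //; exact: small_prod.
apply: card_lt_sub (card_lt_bigcup (small_countable nat) (fun d => H d n)) => t _.
by exists (depth t) => //=.
Qed.

End Language.
End Small.

(** * Saturation *)

(** Dependent choice in which a term may depend on the whole list of its predecessors. *)
Lemma dependent_sequence (T : Type) (R : seq T -> T -> Prop) :
  (forall s, exists x, R s x) -> exists d : nat -> T, forall k, R (mkseq d k) (d k).
Proof.
move=> /choice[G GR]; pose st k := iter k (fun s => rcons s (G s)) [::].
exists (fun k => G (st k)) => k.
by suff -> : mkseq (fun k => G (st k)) k = st k by []; elim: k => // k IH; rewrite mkseqS IH.
Qed.

Section Saturation.
Context (K : Type) (inaccK : strongly_inaccessible K).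
Context (L : language) (M : structure L).
Context (satM : saturated M) (cardM : [set: M] #= [set: K]).
Implicit Types (A C : set M).

Local Notation small_set A := (card_lt A [set: K]).

(** The filter generated by [F] extends to an ultrafilter [U], and the formulas over [A] whose
    solution sets lie in [U] form a complete type. *)
Lemma saturated_dfn1 A (F : set (set M)) : small_set A -> F !=set0 ->
  (forall E, F E -> dfn1 A E /\ E !=set0) ->
  (forall E E', F E -> F E' -> exists2 E'', F E'' & E'' `<=` E `&` E') ->
  exists x, forall E, F E -> E x.
Proof.
move=> [AK KA] [E0 FE0] FA Fdir.
pose G (X : set M) := exists2 E, F E & E `<=` X.
have GP : ProperFilter G.
  split; first by case=> E FE E0'; have [_ [x /E0']] := FA _ FE.
  split=> [|X Y [E FE EX] [E' FE' EY]|X Y XY [E FE EX]].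
  - by exists E0.
  - have [E'' FE'' sE] := Fdir _ _ FE FE'; exists E'' => // x /sE[? ?].
    by split; [exact: EX|exact: EY].
  - by exists E => //; exact: subset_trans XY.
have [U [UU GU]] := ultraFilterLemma GP.
have UP : ProperFilter U by exact: ultra_proper.
pose p := [set phi : pformula M | over A phi /\ U (solutions phi)].
have cp : complete_type A p.
  split=> [phi []//|k s ps|phi oA].
    have : U [set x | forall i, solutions (s i) x].
      suff H (t : seq 'I_k) : U [set x | forall i, i \in t -> solutions (s i) x].
        by apply: filterS (H (enum 'I_k)) => x h i; apply: h; rewrite mem_enum.
      elim: t => [|i t IH]; first by apply: filterS filterT.
      have [_ Ui] := ps i.
      apply: filterS (filterI Ui IH) => x [h1 h2] j.
      by rewrite inE => /predU1P[->|/h2].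
    by move=> /filter_ex[x h]; exists x.
  have [Us|Us] := in_ultra_setVsetC (solutions phi) UU; first by left.
  by right; split.
have [|x rx] := satM _ cp.
  move: cardM; rewrite card_eq_le => /andP[MK KM]; split; first exact: card_le_trans KM.
  by move=> MA; apply: KA; exact: card_le_trans MA.
exists x => E FE; have [/dfn1_formula[phi oA e] _] := FA _ FE; rewrite -e.
by apply: rx; split=> //; apply: GU; exists E => //; rewrite e.
Qed.

(** By induction, some [c] realizes the projections; the remaining coordinate is then found in the
    fibres over [c], with [c] added to the parameters. *)
Lemma saturated_dfn n A (F : set (set ('I_n -> M))) : small_set A -> F !=set0 ->
  (forall E, F E -> dfn A E /\ E !=set0) ->
  (forall E E', F E -> F E' -> exists2 E'', F E'' & E'' `<=` E `&` E') ->
  exists c, forall E, F E -> E c.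
Proof.
move=> sA; elim: n F => [|n IH] F F0 FA Fdir.
  by exists no_tuple => E /FA[_ [v]]; rewrite (no_tupleE v).
pose ul (v : option 'I_n -> M) : 'I_n.+1 -> M := v \o unlift ord0.
pose pr (E : set ('I_n.+1 -> M)) : set ('I_n -> M) := [set v | exists x, E (cons_tuple x v)].
have [|E' [E /FA[dE [v Ev]] <-]|_ _ [E FE <-] [E' FE' <-]|c hc] := IH (pr @` F).
- by case: F0 => E FE; exists (pr E), E.
- split; first exact: (dfn_ex (dfn_ren (unlift ord0) dE)).
  exists (v \o lift ord0), (v ord0); move: Ev; congr E; apply/funext => i.
  by rewrite /cons_tuple; case: unliftP => [j ->|->].
- have [E'' FE'' sE] := Fdir _ _ FE FE'; exists (pr E''); first by exists E''.
  by move=> v [x /sE[? ?]]; split; exists x.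
pose sl (E : set ('I_n.+1 -> M)) : set M := [set x | E (cons_tuple x c)].
have [||E' [E FE <-]|_ _ [E FE <-] [E' FE' <-]|x hx] :=
    @saturated_dfn1 (A `|` range c) (sl @` F).
- apply: card_lt_setU => //; apply: small_image; exact: small_countable.
- by case: F0 => E FE; exists (sl E), E.
- split; last by apply: (hc (pr E)); exists E.
  have [dE _] := FA _ FE; apply: (@dfn1_slice _ _ _ _ (fun v => E (v \o unlift ord0))).
    by move=> i; right; exists i.
  by apply: dfn_mono (dfn_ren (unlift ord0) dE) => y; left.
- have [E'' FE'' sE] := Fdir _ _ FE FE'; exists (sl E''); first by exists E''.
  by move=> x /sE.
by exists (cons_tuple x c) => E FE; apply: (hx (sl E)); exists E.
Qed.

Lemma ultrafilter_realized n A (I : Type) (U : set_system I) (a : I -> ('I_n -> M)) :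
  UltraFilter U -> small_set A ->
  exists c, forall E, dfn A E -> (E c <-> U [set i | E (a i)]).
Proof.
move=> UU sA; have UP : ProperFilter U by exact: ultra_proper.
pose F := [set E | dfn A E /\ U [set i | E (a i)]].
have [||E E' [dE UE] [dE' UE']|c hc] := @saturated_dfn n A F sA.
- by exists setT; split; [exact: dfn_top|exact: filterT].
- by move=> E [dE /filter_ex[i Ei]]; split=> //; exists (a i).
- exists (E `&` E') => //; split; first exact: dfn_and.
  by apply: filterS (filterI UE UE') => i [].
exists c => E dE; split=> [Ec|UE]; last by apply: hc.
have [//|Un] := in_ultra_setVsetC [set i | E (a i)] UU.
have : F (~` E) by split; first exact: dfn_not.
by move=> /hc.
Qed.

(** * Types over a set and independent sequences *)

Definition teq A V (b c : V -> M) : Prop := forall E, dfn A E -> (E b <-> E c).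

Definition teq1 A (x y : M) : Prop := forall E, dfn1 A E -> (E x <-> E y).

Lemma teq1_half A x y : (forall E, dfn1 A E -> E x -> E y) -> teq1 A x y.
Proof.
move=> h E dE; split; first exact: h.
by move=> Ey; apply: contrapT => nEx; exact: (h _ (dfn1_not dE)).
Qed.

Lemma teq1_sym A x y : teq1 A x y -> teq1 A y x.
Proof. by move=> h E dE; rewrite h. Qed.

Lemma teq1_trans A x y z : teq1 A x y -> teq1 A y z -> teq1 A x z.
Proof. by move=> h k E dE; rewrite h // k. Qed.

(** Removing finite sets definable over [C] from the members of [F] leaves nonempty sets; a common
    element avoids [acl C]. *)
Lemma extension_dfn1 A C (F : set (set M)) : small_set C -> A `<=` C -> F !=set0 ->
  (forall E, F E -> dfn1 A E /\ infinite_set E) ->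
  (forall E E', F E -> F E' -> exists2 E'', F E'' & E'' `<=` E `&` E') ->
  exists x, ~ acl C x /\ forall E, F E -> E x.
Proof.
move=> sC AC [E0 FE0] FA Fdir.
pose F' := [set X | exists E Y, [/\ F E, dfn1 C Y, finite_set Y & X = E `\` Y]].
have [|_ [E [Y [/FA[dE iE] dY fY ->]]]|_ _ [E [Y [FE dY fY ->]]] [E' [Y' [FE' dY' fY' ->]]]|x hx] :=
    @saturated_dfn1 C F' sC.
- exists (E0 `\` set0); exists E0, set0; split=> //; exact: dfn_bot.
- split; last exact/infinite_setN0/infinite_setD.
  by apply: dfn1_and; [exact: dfn1_mono dE|exact: dfn1_not].
- have [E'' FE'' sE] := Fdir _ _ FE FE'.
  exists (E'' `\` (Y `|` Y')); last by move=> x [/sE[? ?]]; rewrite not_orE => -[].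
  exists E'', (Y `|` Y'); split=> //; [exact: dfn1_or|by rewrite finite_setU].
exists x; split=> [/aclP[Y [dY Yx fY]]|E FE].
  have /hx[] : F' (E0 `\` Y) by exists E0, Y.
  by [].
have /hx[] // : F' (E `\` set0) by exists E, set0; split=> //; exact: dfn_bot.
Qed.

Lemma extension A C r : small_set C -> A `<=` C -> ~ acl A r ->
  exists2 c, teq1 A c r & ~ acl C c.
Proof.
move=> sC AC nr.
have [||E E' [dE Er] [dE' Er']|c [nc hc]] :=
    @extension_dfn1 A C [set E | dfn1 A E /\ E r] sC AC.
- by exists setT; split=> //; exact: dfn_top.
- move=> E [dE Er]; split=> // fE; apply: nr; apply/aclP; by exists E.
- by exists (E `&` E') => //; split=> //; exact: dfn1_and.
exists c => //; apply: teq1_sym; apply: teq1_half => E dE Er; exact: hc.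
Qed.

Lemma independent_sequence A r : small_set A -> ~ acl A r ->
  exists d : nat -> M, forall k,
    teq1 A (d k) r /\ ~ acl (A `|` [set d j | j in `I_k]) (d k).
Proof.
move=> sA nr.
have [s|d hd] := @dependent_sequence M
    (fun s x => teq1 A x r /\ ~ acl (A `|` [set nth r s i | i in `I_(size s)]) x).
  have [||c ? ?] := @extension A (A `|` [set nth r s i | i in `I_(size s)]) r _ _ nr.
  - apply: card_lt_setU => //; apply: finite_card_lt => //.
    by apply: finite_image; exact: finite_II.
  - by move=> z; left.
  - by exists c.
exists d => k; have [? h] := hd k; split=> // h'; apply: h; apply: acl_mono h' => z [|[j /= jk <-]].
  by left.
by right; exists j; rewrite /= ?size_mkseq ?nth_mkseq.
Qed.

Lemma independent_sequence_inj A d :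
  (forall k, ~ acl (A `|` [set d j | j in `I_k]) (d k)) -> injective (d : nat -> M).
Proof.
move=> h i j e; apply: contrapT => ij.
wlog lt : i j e ij / (i < j)%N.
  move=> H; have : i != j by apply/eqP.
  by rewrite neq_ltn => /orP[/H|/H]; apply=> // ji; apply: ij.
by apply: (h j); apply: acl_incl; right; exists i.
Qed.

End Saturation.

(** * Rank one and exchange *)

Section RankOne.
Context (K : Type) (inaccK : strongly_inaccessible K).
Context (L : language) (M : structure L).
Context (satM : saturated M) (cardM : [set: M] #= [set: K]).
Context (rankM : U_rank M (Eq (Var ord0) (Var ord0)) 1).
Implicit Types (A C : set M).

Local Notation small_set A := (card_lt A [set: K]).

Lemma card_lt_M T (A : set T) : small_set A -> card_lt A [set: M].
Proof.
move=> [AK KA]; move: cardM; rewrite card_eq_le => /andP[MK KM].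
by split=> [|MA]; [exact: card_le_trans KM|apply: KA; exact: card_le_trans MA].
Qed.

Lemma teq_same_type A n (b c : 'I_n -> M) : teq A b c -> same_type A b c.
Proof.
move=> h m phi a Aa; apply: (h (fun v => sat M phi (cat_tuple v a))).
have := @dfn_fix _ M A 'I_n 'I_m _ a Aa
  (dfn_udef A (udef_sat phi (cat_tuple inl inr))).
apply: dfn_ext => v.
suff -> : sumv v a \o cat_tuple inl inr = cat_tuple v a by [].
by apply/funext => i; rewrite /cat_tuple /=; case: fintype.split.
Qed.

Definition type_of A (x : M) : set (pformula M) := [set phi | over A phi /\ solutions phi x].

Lemma type_of_complete A x : complete_type A (type_of A x).
Proof.
split=> [phi []//|k s hs|phi oA]; first by exists x => i; case: (hs i).
by have [|] := EM (solutions phi x); [left|right].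
Qed.

Lemma forks_of_divides A phi : divides phi A -> forks phi A.
Proof. by move=> d; exists 1, (fun=> phi); split=> // x sx; exists ord0. Qed.

(** The type of [x] over [A] and [x] contains the formula [y = x], which divides over [A] because
    the type of [x] over [A] has infinitely many realizations. *)
Lemma U_ge1 A x : small_set A -> ~ acl A x -> U_ge 1 A (type_of A x).
Proof.
move=> sA nx; exists (A `|` [set x]), (type_of (A `|` [set x]) x); split; split.
- by apply/card_lt_M/card_lt_setU => //; apply: finite_card_lt.
- by move=> y; left.
- exact: type_of_complete.
- by move=> phi [oA sx]; split=> // i; left; exact: oA.
- pose psi : pformula M := PFormula (Eq (Var ord0) (Var (lift ord0 ord0))) (fun _ : 'I_1 => x).
  have psiE y : solutions psi y <-> y = x.
    by rewrite /solutions /= cons_tuple0 cons_tuple_lift.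
  exists psi; first by split; [right|apply/psiE].
  apply: forks_of_divides.
  have [d hd] := independent_sequence inaccK satM cardM sA nx.
  have dinj : injective d by apply: (@independent_sequence_inj _ _ A) => k; have [] := hd k.
  exists 2, (fun i _ => d i); split=> [i|s sinj [y hy]].
    apply: teq_same_type => E dE; have [h _] := hd i.
    have := h [set z | E (fun=> z)]; apply.
    exact: (dfn_ren (fun _ : 'I_1 => tt) dE).
  have e j : y = d (s j).
    by have := hy j; rewrite /= cons_tuple0 cons_tuple_lift.
  have /dinj/sinj : d (s ord0) = d (s ord_max) by rewrite -!e.
  by [].
- by [].
Qed.

(* Rank one is used only here: a non-algebraic formula dividing over the empty set would
   start a forking chain of length two. *)
Lemma no_dividing_formula (phi : pformula M) (b : nat -> 'I_(pf_arity phi) -> M) k :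
  infinite_set (solutions phi) -> (forall i, teq set0 (b i) (pf_params (p := phi))) ->
  exists s : 'I_k -> nat, injective s /\
    exists x, forall j, sat M (pf_formula phi) (cons_tuple x (b (s j))).
Proof.
move=> iphi hb; apply: contrapT => none.
have divp : divides phi set0.
  exists k, b; split=> [i|s sinj [x hx]]; first exact: teq_same_type.
  by apply: none; exists s; split=> //; exists x.
pose A := range (pf_params (p := phi)).
have oA : over A phi by move=> i; exists i.
have sA : small_set A by apply: small_image; exact: small_countable.
have [|||E E' -> ->|x [nx hx]] :=
    extension_dfn1 satM cardM (A := A) (C := A) (F := [set solutions phi]) sA.
- by [].
- by exists (solutions phi).
- by move=> E ->; split=> //; apply/dfn1_formula; exists phi.
- by exists (solutions phi).
have [_ /(_ (type_of set0 x) (type_of_complete _ _))] := rankM; apply.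
  by split=> // -[].
exists A, (type_of A x); split; split.
- exact: card_lt_M.
- by [].
- exact: type_of_complete.
- by move=> psi [o sx]; split=> // i; case: (o i).
- by exists phi; [split=> //; exact: hx|exact: forks_of_divides].
- exact: U_ge1.
Qed.

Lemma no_dividing V (D : forall S : structure L, set (option V -> S))
    (b : nat -> V -> M) (c : V -> M) k :
  udef D -> infinite_set [set x | D M (ocons x c)] -> (forall i, teq set0 (b i) c) ->
  exists s : 'I_k -> nat, injective s /\ exists x, forall j, D M (ocons x (b (s j))).
Proof.
move=> /udef_formula[n [phi [f H]]] iD hb.
have [||s [sinj [x hx]]] := @no_dividing_formula (PFormula phi (c \o f)) (fun i => b i \o f) k.
- apply: sub_infinite_set iD => x /=; rewrite /solutions /= => h; exact/H.
- by move=> i E dE; apply: (hb i (fun v => E (v \o f))); exact: dfn_ren.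
by exists s; split=> //; exists x => j; apply/H; exact: hx.
Qed.

Definition exchange (S : structure L) : Prop := forall (A : set S) x y,
  acl (A `|` [set y]) x -> ~ acl A x -> acl (A `|` [set x]) y.

Lemma acl_finite_left (S : structure L) (A B : set S) x : acl (A `|` B) x ->
  exists A' : set S, [/\ finite_set A', A' `<=` A & acl (A' `|` B) x].
Proof.
move=> /acl_finite[k [a [ha ax]]]; exists (A `&` range a); split.
- by apply: finite_setIr; apply: finite_image; exact: finite_finset.
- by move=> y [].
- apply: acl_mono ax => y ya; have [i _ e] := ya.
  by have := ha i; rewrite e => -[?|?]; [left|right].
Qed.

(* If y is not algebraic over A x, then the formula isolating x over A y, viewed as a formula
   in y, is infinite; it divides because each y satisfies it for boundedly many x. *)
Lemma rank_one_exchange : exchange M.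
Proof.
move=> A x y axy nax.
have [A' [fA' sA' {}axy]] := acl_finite_left axy.
have {}nax : ~ acl A' x by move=> h; apply: nax; exact: acl_mono h.
apply: (@acl_mono _ _ (A' `|` [set x])) => [z [?|?]|]; [left; exact: sA'|by right|].
have {sA' fA'} sA : small_set A' by exact: finite_card_lt.
apply: contrapT => nay.
have [E [dE Ex /finite_ngeq_card[k Ek]]] := (aclP _ _).1 axy.
have [] := @dfn1_param _ _ A' unit (fun=> y) E.
  by apply: dfn1_mono dE => z [|->]; [left|right; exists tt].
move=> G [[W [D [b [uD Ab H]]]] eE].
have {}H u v : G (ocons u (fun=> v)) <-> D M (sumv (ocons u (fun=> v)) b) by exact: H.
(* These renamings turn the formula around: in [F], the point in the place of [y] becomes the
   solution variable and the point in the place of [x] a parameter. *)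
pose g (s : option unit + W) : option (option unit + W) :=
  match s with
  | inl None => Some (inl None) | inl (Some _) => None | inr w => Some (inr w) end.
pose h (s : option unit + W) : option (option (option unit + W)) :=
  match s with
  | inl None => None | inl (Some _) => Some None | inr w => Some (Some (inr w)) end.
pose F (S : structure L) (w : option (option unit + W) -> S) :=
  D S (w \o g) /\ ~ geq_card k [set z | D S (ocons z w \o h)].
have uF : udef F.
  apply: udef_and; first exact: udef_ren.
  apply: udef_not; apply: (@udef_geq_card _ _ k (fun S w => D S (w \o h))).
  exact: udef_ren.
pose par u : option unit + W -> M := sumv (fun=> u) b.
have FE u v : F M (ocons v (par u)) <->
    G (ocons u (fun=> v)) /\ ~ geq_card k [set z | G (ocons z (fun=> v))].
  rewrite /F H.
  have -> : ocons v (par u) \o g = sumv (ocons u (fun=> v)) b by apply/funext => -[[]|].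
  suff -> : [set z | D M (ocons z (ocons v (par u)) \o h)] = [set z | G (ocons z (fun=> v))] by [].
  apply/seteqP; split=> z /=; rewrite H;
    suff -> : ocons z (ocons v (par u)) \o h = sumv (ocons z (fun=> v)) b by [];
    by apply/funext => -[[]|].
have [d hd] := independent_sequence inaccK satM cardM sA nax.
have dinj : injective d by apply: (@independent_sequence_inj _ _ A') => i; have [] := hd i.
have [||s [sinj [v hv]]] := @no_dividing _ F (fun i => par (d i)) (par x) k uF.
- move=> fin; apply: nay; apply/aclP; exists [set v | F M (ocons v (par x))]; split=> //.
    apply: (@dfn1_slice _ _ _ _ (F M)); last exact: dfn_udef.
    by move=> [u|w] /=; [right|left].
  by apply/FE; rewrite -eE; split=> //; move: Ex; rewrite eE.
- move=> i E' dE'; have [teqd _] := hd i.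
  have := teqd [set u | E' (par u)]; apply.
  pose r (s : option unit + W) : unit + W := match s with inl _ => inl tt | inr w => inr w end.
  have := dfn_fix Ab (dfn_mono (@sub0set _ A') (dfn_ren r dE')).
  apply: dfn_ext => w; suff -> : sumv w b \o r = par (w tt) by [].
  by apply/funext => -[].
(* For [k = 0] there is no index to use, but [Ek] is then already absurd. *)
have [j0|k0] := pselect (inhabited 'I_k); last first.
  by move: Ek; case: (k) k0 => // k' []; exists; exact: ord0.
have [j] := j0; have [_] := (FE _ _).1 (hv j); apply.
apply: (@geq_card_inj _ _ (d \o s)); first exact: inj_comp.
by move=> i; have [] := (FE _ _).1 (hv i).
Qed.

End RankOne.

(** * Elementary tuples in different models *)

Section Elementary.
Context (L : language).

Definition elem (S S' : structure L) V (a : V -> S) (b : V -> S') : Prop :=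
  forall D, udef D -> (D S a <-> D S' b).

Lemma elem_sym (S S' : structure L) V (a : V -> S) (b : V -> S') : elem a b -> elem b a.
Proof. by move=> h D uD; rewrite (h D uD). Qed.

Lemma elem_half (S S' : structure L) V (a : V -> S) (b : V -> S') :
  (forall D, udef D -> D S a -> D S' b) -> elem a b.
Proof.
move=> h D uD; split; first exact: h.
move=> Db; apply: contrapT => nDa.
exact: (h (fun S v => ~ D S v) (udef_not uD)).
Qed.

(** A bound [k] on the number of solutions is first order, so the formula and its bound are carried
    over together as one property [D] of the tuple. *)
Lemma elem_acl (S S' : structure L) V (a : V -> S) (b : V -> S') (J : set V) i :
  elem a b -> acl (a @` J) (a i) -> acl (b @` J) (b i).
Proof.
move=> h [[n phi p] [op si /finite_ngeq_card[k sk]]].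
have {op} /choice[f /all_and2[Jf fp]] : forall j : 'I_n, exists v, J v /\ a v = p j.
  by move=> j; have [v Jv e] := op j; exists v.
have {}fp : p = a \o f by apply/funext => j; rewrite /= fp.
pose G (S : structure L) (w : option V -> S) :=
  sat S phi (cons_tuple (w None) (w \o Some \o f)).
have uG : udef G.
  apply: udef_ext (udef_sat phi (cons_tuple None (Some \o f))) => S0 v.
  by rewrite cons_tuple_comp.
pose D (S : structure L) (v : V -> S) :=
  G S (ocons (v i) v) /\ ~ geq_card k [set x | G S (ocons x v)].
have uD : udef D.
  apply: udef_and; last by apply: udef_not; exact: (@udef_geq_card _ _ k G).
  apply: udef_ext (udef_ren (fun o => odflt i o) uG) => S0 v.
  by suff -> : ocons (v i) v = v \o odflt i by []; apply/funext => -[].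
have /(h D uD)[Gi nG] : D S a.
  by split; [rewrite /G; move: si; rewrite fp|move: sk; rewrite fp].
apply/aclP; exists [set x | G S' (ocons x b)]; split=> //; last exact: ngeq_card_finite nG.
apply/dfn1_formula; exists (PFormula phi (b \o f)) => //.
by move=> j; exists (f j).
Qed.

Lemma ex_closure n (phi : formula L n) : exists psi : sentence L,
  forall S : structure L, holds S psi <-> exists v : 'I_n -> S, sat S phi v.
Proof.
elim: n phi => [|n IH] phi.
  exists phi => S; split=> [h|[v]]; first by exists no_tuple.
  by rewrite (no_tupleE v).
have [psi h] := IH (Neg (All (Neg phi))); exists psi => S; rewrite h /=; split.
  move=> [v hv]; apply: contrapT => nv; apply: hv => x hx; apply: nv.
  by exists (cons_tuple x v).
move=> [v hv]; exists (v \o lift ord0) => /(_ (v ord0)); apply.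
move: hv; congr sat; apply/funext => i.
by rewrite /cons_tuple; case: unliftP => [j ->|->].
Qed.

Context (T : set (sentence L)) (complT : complete_theory T).

Lemma complete_models (S S' : structure L) phi :
  models T S -> models T S' -> holds S phi -> holds S' phi.
Proof.
move=> mS mS' hS; have [_ /(_ phi)[|h]] := complT; first exact.
by have := h S mS hS.
Qed.

Context (K : Type) (inaccK : strongly_inaccessible K) (M : structure L).
Context (satM : saturated M) (cardM : [set: M] #= [set: K]) (modM : models T M).

(** By completeness every formula true of [c] has a solution in [M], so the type of [c] over the
    empty set is finitely satisfiable there. *)
Lemma elem_realized (S : structure L) n (c : 'I_n -> S) : models T S ->
  exists c' : 'I_n -> M, elem c c'.
Proof.
move=> mS.
pose F := [set E : set ('I_n -> M) |
  exists2 D : forall S : structure L, set ('I_n -> S), udef D & D S c /\ E = D M].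
have [||_ [D uD [Dc ->]]|_ _ [D uD [Dc ->]] [D' uD' [Dc' ->]]|c' hc'] :=
    @saturated_dfn _ inaccK _ _ satM cardM n set0 F.
- exact: finite_card_lt.
- by exists setT, (fun S v => True); first exact: udef_top.
- split; first exact: dfn_udef.
  have [m [phi [f H]]] := uD.
  have [psi hpsi] := ex_closure (ren phi f).
  have /hpsi[v] : holds M psi.
    by apply: complete_models mS modM _; apply/hpsi; exists c; apply/sat_ren/H.
  by rewrite sat_ren -H; exists v.
- exists (fun v => D M v /\ D' M v) => //.
  by exists (fun S v => D S v /\ D' S v); first exact: udef_and.
exists c'; apply: elem_half => D uD Dc; apply: (hc' (D M)).
by exists D.
Qed.

(** A failure of exchange involves finitely many elements, and by [elem_acl] it depends only on
    their type, which is realized in [M]. *)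
Lemma exchange_models (S : structure L) : exchange M -> models T S -> exchange S.
Proof.
move=> exM mS A x y axy nax.
have [A' [fA' sA' {}axy]] := acl_finite_left axy.
have {}nax : ~ acl A' x by move=> h; apply: nax; exact: acl_mono h.
apply: (@acl_mono _ _ (A' `|` [set x])) => [z [?|?]|]; [left; exact: sA'|by right|].
have /finite_seqP[s es] : @finite_set {classic S} A' := fA'.
pose a (i : 'I_(size s)) : S := tnth (in_tuple s) i.
have {es sA' fA'} eA' : A' = range a.
  rewrite es; apply/seteqP; split=> z /=.
    by move=> /(tnthP (in_tuple s))[i ->]; exists i.
  by move=> [i _ <-]; exact: mem_tnth.
pose c := cons_tuple x (cons_tuple y a).
have [c' hc] := elem_realized c mS.
pose j1 : 'I_(size s).+2 := lift ord0 ord0.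
pose J : set 'I_(size s).+2 := range (fun i => lift ord0 (lift ord0 i)).
have cx : c ord0 = x by rewrite /c cons_tuple0.
have cy : c j1 = y by rewrite /c cons_tuple_lift cons_tuple0.
have cJ : c @` J = A'.
  rewrite eA'; apply/seteqP; split=> z.
    by move=> [_ [i _ <-] <-]; exists i => //; rewrite /c !cons_tuple_lift.
  move=> [i _ <-]; exists (lift ord0 (lift ord0 i)); first by exists i.
  by rewrite /c !cons_tuple_lift.
have : acl (c @` (J `|` [set ord0])) (c j1).
  apply: (elem_acl (elem_sym hc)); rewrite image_setU image_set1.
  apply: exM.
    rewrite -image_set1 -image_setU; apply: (elem_acl hc).
    by rewrite image_setU image_set1 cJ cx cy.
  by move=> /(elem_acl (elem_sym hc)); rewrite cJ cx.
by rewrite image_setU image_set1 cJ cx cy.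
Qed.

End Elementary.

(** * Finitely many instances modulo finite sets *)

Section FiniteInstances.
Context (K : Type) (inaccK : strongly_inaccessible K).
Context (L : language) (T : set (sentence L)) (M : structure L).
Context (satM : saturated M) (cardM : [set: M] #= [set: K]).
Context (rankM : U_rank M (Eq (Var ord0) (Var ord0)) 1).
Context (stabT : stable T) (modM : models T M).

Definition indiscernible n (c : nat -> 'I_n -> M) : Prop :=
  forall m (E : set ('I_m * 'I_n -> M)) (g h : 'I_m -> nat), dfn set0 E ->
    {homo g : i j / (i < j)%N} -> {homo h : i j / (i < j)%N} ->
    (E (fun p => c (g p.1) p.2) <-> E (fun p => c (h p.1) p.2)).

(* The pairs (c_2j, c_2j+1) realize one type, so rank one gives an x for which phi(x, c_i)
   alternates along arbitrarily long sequences; by indiscernibility phi has the order property. *)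
Lemma indiscernible_diff_finite n (phi : formula L n.+1) (c : nat -> 'I_n -> M) :
  indiscernible c ->
  finite_set [set x | sat M phi (cons_tuple x (c 0)) /\ ~ sat M phi (cons_tuple x (c 1))].
Proof.
move=> ic; apply: contrapT => inf.
pose D (S : structure L) (w : option (bool * 'I_n) -> S) :=
  sat S phi (w \o cons_tuple None (fun i => Some (false, i))) /\
  ~ sat S phi (w \o cons_tuple None (fun i => Some (true, i))).
have uD : udef D by apply: udef_and; [|apply: udef_not]; exact: udef_sat.
pose b j (p : bool * 'I_n) : M := c (j.*2 + p.1) p.2.
have DE j x : D M (ocons x (b j)) <->
    sat M phi (cons_tuple x (c j.*2)) /\ ~ sat M phi (cons_tuple x (c j.*2.+1)).
  by rewrite /D !cons_tuple_comp /comp /= /b /= addn0 addn1.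
have alt k : exists t : 'I_k -> nat, {homo t : i j / (i < j)%N} /\ exists x, forall j,
    sat M phi (cons_tuple x (c (t j).*2)) /\ ~ sat M phi (cons_tuple x (c (t j).*2.+1)).
  have [||s [sinj [x hx]]] := no_dividing inaccK satM cardM rankM (D := D) (b := b) (c := b 0) k uD.
  - by apply: sub_infinite_set inf => x hx; apply/DE.
  - move=> j E dE.
    pose r (p : bool * 'I_n) : 'I_2 * 'I_n := (if p.1 then ord_max else ord0, p.2).
    have := ic 2 (fun v => E (v \o r)) (fun i => j.*2 + i) (fun i => 0.*2 + i) (dfn_ren r dE).
    have er l : (fun p : 'I_2 * 'I_n => c (l.*2 + p.1) p.2) \o r = b l.
      by apply/funext => -[[] i].
    by rewrite !er; apply=> i i' ii'; rewrite ltn_add2l.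
  (* The indices in [s] are only distinct; sorting makes them increasing. *)
  pose S := sort leq (codom s).
  have sS : size S = k by rewrite size_sort size_codom card_ord.
  exists (fun j => nth 0 S j); split.
    move=> i j ij; have : sorted ltn S.
      rewrite ltn_sorted_uniq_leq sort_uniq map_inj_uniq // enum_uniq /=.
      by apply: sort_sorted; exact: leq_total.
    by move=> /(sorted_ltn_nth ltn_trans 0); apply=> //; rewrite inE sS.
  exists x => j; have : nth 0 S j \in codom s by rewrite -(mem_sort leq) mem_nth ?sS.
  by move=> /codomP[j' ->]; apply/DE; exact: hx.
have ord k l : exists x, forall i : 'I_k, sat M phi (cons_tuple x (c i)) <-> (l < i)%N.
  have [t [tinc [x hx]]] := alt k.
  (* The odd term of the pair, where [phi] fails, is taken for [i <= l], and the even term, where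
     [phi] holds, for [l < i]. *)
  pose g (i : 'I_k) := (t i).*2 + (i <= l)%N.
  have ginc : {homo g : i j / (i < j)%N}.
    move=> i j /tinc; rewrite -leq_double doubleS => tij.
    apply: (@leq_trans (t j).*2); last exact: leq_addr.
    by apply: leq_trans tij; rewrite ltnS -addn1 leq_add2l leq_b1.
  pose E (u : 'I_k * 'I_n -> M) := exists x, forall i,
    sat M phi (cons_tuple x (fun i' => u (i, i'))) <-> (l < i)%N.
  have dE : dfn set0 E.
    pose F (w : option ('I_k * 'I_n) -> M) := forall i : 'I_k,
      sat M phi (w \o cons_tuple None (fun i' => Some (i, i'))) <-> (l < i)%N.
    apply: (@dfn_ext _ _ _ _ (fun u => exists x, F (ocons x u))).
      by move=> u; split=> -[y hy]; exists y => i; rewrite -hy cons_tuple_comp.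
    apply: dfn_ex; apply: dfn_forall_fin => i; apply: dfn_iff; last exact: dfn_const.
    exact: (dfn_udef set0 (udef_sat phi _)).
  have [fwd _] := ic k E g val dE ginc (fun _ _ => id).
  have [|y hy] := fwd; last by exists y.
  exists x => i; rewrite /g; case: leqP => li /=.
    by rewrite addn1; split=> // h; case: (hx i) => _ /(_ h).
  by rewrite addn0; split=> // _; case: (hx i).
(* Saturation passes from the finite patterns of [ord] to the whole sequence [c]. *)
have /choice[a ha] : forall l, exists x, forall i, sat M phi (cons_tuple x (c i)) <-> (l < i)%N.
  move=> l; pose A := range (fun p : nat * 'I_n => c p.1 p.2).
  pose X k := [set x | forall i : 'I_k, sat M phi (cons_tuple x (c i)) <-> (l < i)%N].
  have XS k k' : (k <= k')%N -> X k' `<=` X k.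
    by move=> kk' x hx i; have := hx (widen_ord kk' i).
  have [|||_ _ [k _ <-] [k' _ <-]|x hx] :=
      saturated_dfn1 satM cardM (A := A) (F := range X).
  - by apply: small_image; exact: small_countable.
  - by exists (X 0), 0.
  - move=> _ [k _ <-]; split; last by have [x hx] := ord k l; exists x.
    apply: dfn_forall_fin => i; apply: dfn_iff; last exact: dfn_const.
    apply: (dfn1_formula A [set x | sat M phi (cons_tuple x (c i))]).2.
    exists (PFormula phi (c i)) => // j.
    by exists (nat_of_ord i, j).
  - exists (X (maxn k k')); first by exists (maxn k k').
    by move=> x hx; split; apply: XS hx; rewrite ?leq_maxl ?leq_maxr.
  exists x => i; have := hx (X i.+1) (ex_intro2 _ _ i.+1 Logic.I erefl) ord_max.
  by [].
apply: (@stabT 1 n (ren phi (cons_tuple (lshift n ord0) (@rshift 1 n))) M modM).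
exists (fun i _ => a i), c => i j; rewrite sat_ren cons_tuple_comp -ha.
have -> : cat_tuple (fun _ : 'I_1 => a i) (c j) (lshift n ord0) = a i.
  by rewrite /cat_tuple (unsplitK (inl _ (ord0 : 'I_1))).
suff -> : cat_tuple (fun _ : 'I_1 => a i) (c j) \o @rshift 1 n = c j by [].
by apply/funext => i'; rewrite /= /cat_tuple (unsplitK (inr _ i')).
Qed.

(* Each c_k realizes the type of the ultrafilter U over all a_i and the earlier c_j. *)
Lemma ultrafilter_sequence n (U : set_system nat) (a : nat -> 'I_n -> M) : UltraFilter U ->
  exists c : nat -> 'I_n -> M, forall k E,
    dfn ([set a i j | i in setT & j in setT] `|` [set c i j | i in `I_k & j in setT]) E ->
    (E (c k) <-> U [set i | E (a i)]).
Proof.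
move=> UU; pose A := [set a i j | i in setT & j in setT].
pose B (s : seq ('I_n -> M)) := A `|` [set nth (a 0) s i j | i in `I_(size s) & j in setT].
have [s|c hc] := @dependent_sequence ('I_n -> M)
    (fun s y => forall E, dfn (B s) E -> (E y <-> U [set i | E (a i)])).
  apply: (ultrafilter_realized inaccK satM cardM a UU); apply: card_lt_setU => //.
    apply: card_lt_sub (small_image (fun p : nat * 'I_n => a p.1 p.2) (small_countable inaccK _)).
    by move=> _ [i _ [j _ <-]]; exists (i, j).
  apply: card_lt_sub (small_image (fun p : nat * 'I_n => nth (a 0) s p.1 p.2)
    (small_countable inaccK _)).
  by move=> _ [i _ [j _ <-]]; exists (i, j).
exists c => k E dE; apply: hc; apply: dfn_mono dE => z [?|[i ik [j _ <-]]]; first by left.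
by right; exists i; rewrite /= ?size_mkseq //; exists j; rewrite ?nth_mkseq.
Qed.

(** Induction on the number of indices: by the choice of the last term, [E] holds at an increasing
    tuple exactly when it holds with [a i] in the last place for [U]-almost all [i]. The claim [H]
    allows parameters in [A] because these [a i] become parameters. *)
Lemma ultrafilter_sequence_indiscernible n (U : set_system nat) (a c : nat -> 'I_n -> M) :
  (forall k E,
    dfn ([set a i j | i in setT & j in setT] `|` [set c i j | i in `I_k & j in setT]) E ->
    (E (c k) <-> U [set i | E (a i)])) -> indiscernible c.
Proof.
move=> hc; pose A := [set a i j | i in setT & j in setT].
suff H m (E : set ('I_m * 'I_n -> M)) (g : 'I_m -> nat) : dfn A E ->
    {homo g : i j / (i < j)%N} ->
    (E (fun p => c (g p.1) p.2) <-> E (fun p => c p.1 p.2)).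
  move=> m E g h dE ginc hinc; have {}dE : dfn A E by apply: dfn_mono dE => x.
  by rewrite !H.
elim: m E g => [|m IH] E g dE ginc.
  by suff -> : (fun p : 'I_0 * 'I_n => c (g p.1) p.2) = (fun p => c p.1 p.2) by [];
    apply/funext => -[[]].
pose r (p : 'I_m.+1 * 'I_n) : 'I_n + 'I_m * 'I_n :=
  if unlift ord_max p.1 is Some j then inr (j, p.2) else inl p.2.
pose mk (u : 'I_m * 'I_n -> M) (v : 'I_n -> M) := sumv v u \o r.
have mkE (f : 'I_m.+1 -> nat) :
    (fun p => c (f p.1) p.2) = mk (fun p => c (f (lift ord_max p.1)) p.2) (c (f ord_max)).
  by apply/funext => -[i i']; rewrite /mk /r /=; case: unliftP => [j ->|->].
have key (f : 'I_m.+1 -> nat) : {homo f : i j / (i < j)%N} ->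
    E (fun p => c (f p.1) p.2) <->
    U [set i | E (mk (fun p => c (f (lift ord_max p.1)) p.2) (a i))].
  move=> finc; rewrite mkE; apply: (hc _ (fun v => E (mk _ v))).
  apply: (dfn_fix (E := fun w => E (w \o r))) => [[j j']|].
    right; exists (f (lift ord_max j)); last by exists j'.
    by apply: finc; rewrite lift_max.
  by apply: dfn_mono (dfn_ren r dE) => x; left.
rewrite key // key //.
suff -> : [set i | E (mk (fun p => c (g (lift ord_max p.1)) p.2) (a i))] =
          [set i | E (mk (fun p => c (lift ord_max p.1) p.2) (a i))] by [].
have IHi i : E (mk (fun p => c (g (lift ord_max p.1)) p.2) (a i)) <->
             E (mk (fun p => c p.1 p.2) (a i)).
  apply: (IH (fun u => E (mk u (a i))) (fun j => g (lift ord_max j))).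
    pose r' (p : 'I_m.+1 * 'I_n) : 'I_m * 'I_n + 'I_n :=
      if unlift ord_max p.1 is Some j then inl (j, p.2) else inr p.2.
    have aA j : A (a i j) by exists i => //; exists j.
    have := dfn_fix aA (dfn_ren r' dE).
    apply: dfn_ext => u; suff -> : sumv u (a i) \o r' = mk u (a i) by [].
    by apply/funext => -[j j']; rewrite /mk /r /r' /=; case: unlift.
  by move=> j j' jj'; apply: ginc; rewrite !lift_max.
have e : (fun p : 'I_m * 'I_n => c (lift ord_max p.1) p.2) = (fun p => c p.1 p.2).
  by apply/funext => p; rewrite lift_max.
by apply/seteqP; split=> i /=; rewrite e IHi.
Qed.

Definition differ n (phi : formula L n.+1) (y z : 'I_n -> M) : set M :=
  [set x | ~ (sat M phi (cons_tuple x y) <-> sat M phi (cons_tuple x z))].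

Lemma dfn_differ_geq A n (phi : formula L n.+1) (y : 'I_n -> M) m :
  (forall i, A (y i)) -> dfn A (fun z => geq_card m (differ phi y z)).
Proof.
move=> Ay.
pose E (w : option ('I_n + 'I_n) -> M) := ~
  (sat M phi (w \o cons_tuple None (Some \o inr)) <->
   sat M phi (w \o cons_tuple None (Some \o inl))).
have dE : dfn A E.
  by apply: dfn_not; apply: dfn_iff; exact: (dfn_udef A (udef_sat phi _)).
have := dfn_fix Ay (dfn_geq_card m dE); apply: dfn_ext => z.
suff -> : [set x | E (ocons x (sumv z y))] = differ phi y z by [].
by apply/seteqP; split=> x; rewrite /E /differ /= !cons_tuple_comp.
Qed.

(** Otherwise some sequence [a] of parameters has instances differing pairwise by infinite sets; the
    sequence [c] drawn from it then contradicts [indiscernible_diff_finite]. *)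
Lemma finite_representatives n (phi : formula L n.+1) :
  exists s : seq ('I_n -> M), forall y, exists2 i, (i < size s)%N &
    finite_set (differ phi (nth y s i) y).
Proof.
apply: contrapT => nos.
have [s|a ha] := @dependent_sequence ('I_n -> M)
    (fun s y => forall i, (i < size s)%N -> infinite_set (differ phi (nth y s i) y)).
  apply: contrapT => noy; apply: nos; exists s => y.
  apply: contrapT => noi; apply: noy; exists y => i si fin; apply: noi.
  by exists i.
have {}ha i j : (i < j)%N -> infinite_set (differ phi (a i) (a j)).
  by move=> ij; have := ha j i; rewrite size_mkseq nth_mkseq //; apply.
(* The filter of sets containing a tail, so that only large indices matter for [U]. *)
pose G (X : set nat) := exists N, forall i, (N <= i)%N -> X i.
have GP : ProperFilter G.
  split; first by case=> N /(_ N (leqnn N)).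
  split=> [|X Y [N hN] [N' hN']|X Y XY [N hN]].
  - by exists 0.
  - exists (maxn N N') => i; rewrite geq_max => /andP[? ?].
    by split; [exact: hN|exact: hN'].
  - by exists N => i /hN /XY.
have [U [UU GU]] := ultraFilterLemma GP.
have UP : ProperFilter U by exact: ultra_proper.
have [c hc] := ultrafilter_sequence a UU.
have ic := ultrafilter_sequence_indiscernible hc.
have differC y z : differ phi y z = differ phi z y.
  by apply/seteqP; split=> x h e; apply: h; rewrite e.
(* For each [m], differing in at least [m] points is definable over [a w], so it passes from the
   later [a i] to [c 0]; in the same way [inf1] passes from the [a i] to [c 1]. *)
have inf0 w : infinite_set (differ phi (a w) (c 0)).
  apply/infinite_geq_card => m; apply/(hc 0 (fun z => geq_card m (differ phi (a w) z))).
    by apply: dfn_differ_geq => i; left; exists w => //; exists i.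
  apply: GU; exists w.+1 => i wi /=; apply: geq_card_infinite; exact: ha.
have inf1 : infinite_set (differ phi (c 0) (c 1)).
  apply/infinite_geq_card => m; apply/(hc 1 (fun z => geq_card m (differ phi (c 0) z))).
    by apply: dfn_differ_geq => i; right; exists 0 => //; exists i.
  apply: GU; exists 0 => i _ /=; apply: geq_card_infinite; rewrite differC; exact: inf0.
(* Each application of [indiscernible_diff_finite] controls one half of the symmetric difference;
   [Neg phi] gives the other half. *)
apply: inf1; apply: (@sub_finite_set _ _
  ([set x | sat M phi (cons_tuple x (c 0)) /\ ~ sat M phi (cons_tuple x (c 1))] `|`
   [set x | sat M (Neg phi) (cons_tuple x (c 0)) /\ ~ sat M (Neg phi) (cons_tuple x (c 1))])).
  move=> x; rewrite /differ /=.
  have [h0|h0] := EM (sat M phi (cons_tuple x (c 0)));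
    have [h1|h1] := EM (sat M phi (cons_tuple x (c 1))) => h.
  - by case: h.
  - by left.
  - by right; split=> // /(_ h1).
  - by case: h; split=> ?.
by rewrite finite_setU; split; exact: indiscernible_diff_finite.
Qed.

End FiniteInstances.

(** * A lovely pair with a small predicate *)

Section SmallPair.
Context (K : Type) (inaccK : strongly_inaccessible K).
Context (L : language) (smallL : small K (symbols L)).
Context (T : set (sentence L)) (M : structure L).
Context (satM : saturated M) (cardM : [set: M] #= [set: K]).
Context (rankM : U_rank M (Eq (Var ord0) (Var ord0)) 1).
Context (stabT : stable T) (modM : models T M).
Implicit Types (A B C P : set M).

Local Notation small_set A := (card_lt A [set: K]).

(** The algebraic closure is a union, over formulas and tuples from [A], of finite solution sets;
    [F] is empty by default where the solution set is infinite. *)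
Lemma small_acl A : small_set A -> small_set (acl A).
Proof.
move=> /card_lt_set_type sA.
pose F n (phi : formula L n.+1) (b : 'I_n -> A) : set M :=
  let E := solutions (PFormula phi (fun i => set_val (b i))) in
  if pselect (finite_set E) then E else set0.
apply: (@card_lt_sub _ _ _ (\bigcup_n \bigcup_phi \bigcup_b @F n phi b)).
  move=> x [[n phi p] [op sx fin]].
  have pA i : p i \in A by apply/mem_set; exact: op.
  exists n => //; exists phi => //; exists (fun i => SigSub (pA i)) => //.
  by rewrite /F; case: pselect.
apply: card_lt_bigcup => //[|n]; first exact: small_countable.
apply: card_lt_bigcup => //[|phi]; first exact: small_formula.
apply: card_lt_bigcup => //[|b]; first exact: small_fun (small_countable _ _) _.
by apply: finite_card_lt => //; rewrite /F; case: pselect.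
Qed.

Lemma small_representatives : exists M0 : set M, small_set M0 /\
  forall n (phi : formula L n.+1) y, exists2 y0, forall i, M0 (y0 i) &
    finite_set (differ phi y0 y).
Proof.
pose rep n (phi : formula L n.+1) :=
  projT1 (cid (finite_representatives inaccK satM cardM rankM stabT modM phi)).
pose I := {n & {phi : formula L n.+1 & 'I_(size (rep n phi)) * 'I_n}}%type.
pose f (p : I) : M := tnth (in_tuple (rep _ (projT1 (projT2 p)))) (projT2 (projT2 p)).1
  (projT2 (projT2 p)).2.
exists (range f); split.
  apply: small_image; apply: small_sigma => //[|n]; first exact: small_countable.
  apply: small_sigma => //[|phi]; first exact: small_formula.
  exact: small_countable.
move=> n phi y.
have [i si fin] := projT2 (cid (finite_representatives inaccK satM cardM rankM stabT modM phi)) y.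
exists (nth y (rep n phi) i) => // j.
by exists (existT _ n (existT _ phi (Ordinal si, j))); rewrite // /f /= (tnth_nth y).
Qed.

Section Stationary.
Context (M0 : set M).
Context (repM0 : forall n (phi : formula L n.+1) y,
  exists2 y0, forall i, M0 (y0 i) & finite_set (differ phi y0 y)).

(** An instance of [phi] over [A] agrees with one over [M0] off a finite set definable over [M0] and
    [A], and neither [c] nor [c'] lies in that set. *)
Lemma stationary A c c' : ~ acl (M0 `|` A) c -> ~ acl (M0 `|` A) c' ->
  teq1 M0 c c' -> teq1 A c c'.
Proof.
move=> nc nc' t; apply: teq1_half => E /dfn1_formula[[n phi y] oy <-].
have [y0 My0 fin] := repM0 phi y.
have dX : dfn1 (M0 `|` A) (differ phi y0 y).
  have dsol z : (forall i, (M0 `|` A) (z i)) ->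
      dfn1 (M0 `|` A) [set x | sat M phi (cons_tuple x z)].
    by move=> hz; apply/dfn1_formula; exists (PFormula phi z).
  apply: dfn1_not; apply: dfn_iff; apply: dsol => i; first by left.
  by right; exact: oy.
have key x : ~ acl (M0 `|` A) x -> (sat M phi (cons_tuple x y0) <-> sat M phi (cons_tuple x y)).
  move=> nx; apply: contrapT => ne; apply: nx; apply/aclP.
  by exists (differ phi y0 y).
rewrite /solutions /= -!key //.
apply: (t [set x | sat M phi (cons_tuple x y0)] _).1.
by apply/dfn1_formula; exists (PFormula phi y0).
Qed.

(* Exchange: an element of A that makes some d_k algebraic can be traded for d_0, ..., d_k,
   after which the tail of d is still independent. *)
Lemma independent_avoids_finite A B (d : nat -> M) : finite_set A ->
  (forall k, ~ acl (B `|` [set d j | j in `I_k]) (d k)) ->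
  exists k, ~ acl (B `|` A) (d k).
Proof.
move=> fA; have /finite_seqP[s ->] : @finite_set {classic M} A := fA.
elim: s B d => [|a s IH] B d hd.
  exists 0 => h; apply: (hd 0); apply: acl_mono h => x [|//]; by left.
apply: contrapT => none.
have {}none k : acl (B `|` [set` (a :: s)]) (d k) by apply: contrapT => ?; apply: none; exists k.
(* If [d] were independent over [B] and [a], the induction hypothesis would apply at once; [k0] is
   where this fails. *)
have [k0 hk0] : exists k0, acl (B `|` [set d j | j in `I_k0] `|` [set a]) (d k0).
  apply: contrapT => nk.
  have [|k] := IH (B `|` [set a]) d.
    move=> k h; apply: nk; exists k; apply: acl_mono h => x [[|]|];
      by [left; left|right|left; right].
  apply; apply: acl_mono (none k) => x /= [|]; first by left; left.
  by rewrite inE => /predU1P[->|]; [left; right|right].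
have ha := rank_one_exchange inaccK satM cardM rankM hk0 (hd k0).
pose B' := B `|` [set d j | j in `I_k0.+1].
have {}ha : acl B' a.
  apply: acl_mono ha => x [[|[j jk <-]]|->]; [by left| |]; right.
    by exists j => //=; exact: ltnW.
  by exists k0 => /=.
have [|k] := IH B' (fun k => d (k0.+1 + k)).
  move=> k h; apply: (hd (k0.+1 + k)); apply: acl_mono h => x [[|[j jk <-]]|[j jk <-]].
  - by left.
  - by right; exists j => //=; apply: leq_trans jk (leq_addr _ _).
  - by right; exists (k0.+1 + j) => //=; rewrite ltn_add2l.
apply; apply: acl_trans (none (k0.+1 + k)) => x [Bx|/=].
  by apply: acl_incl; left; left.
rewrite inE => /predU1P[->|xs]; last by apply: acl_incl; right.
by apply: acl_mono ha => z; left.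
Qed.

End Stationary.

(** The coheir condition with the type given by a realization [r], which saturation provides. *)
Definition dense P : Prop := forall A r, finite_set A -> ~ acl A r ->
  exists2 c, P c & teq1 A c r.

Lemma small_dense_set : exists Q : set M, [/\ small_set Q, acl Q `<=` Q & dense Q].
Proof.
have [M0 [sM0 repM0]] := small_representatives.
have /card_lt_set_type sM0' := sM0.
(* [code x] is the type of [x] over [M0], recorded as a subset of a small type, so that there are
   few types. *)
pose code (x : M) : set {n & (formula L n.+1 * ('I_n -> M0))%type} :=
  [set p | sat M (projT2 p).1 (cons_tuple x (fun i => set_val ((projT2 p).2 i)))].
have codeP x y : code x = code y -> teq1 M0 x y.
  move=> e; apply: teq1_half => E /dfn1_formula[[n phi b] ob <-] sx.
  have bM i : b i \in M0 by apply/mem_set; exact: ob.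
  have : code x (existT _ n (phi, fun i => SigSub (bM i))) by [].
  by rewrite e.
have [x0 _] : exists x : M, True.
  have [[natK _] _ _] := inaccK; move: cardM; rewrite card_eq_le => /andP[_ KM].
  have /card_le_injP[f _] := card_le_trans natK KM.
  by exists (f 0).
(* One sequence for each type [t]; the constant [x0] is a default when [t] has no non-algebraic
   realization. *)
have /choice[d hd] : forall t, exists d : nat -> M, forall r, code r = t -> ~ acl M0 r ->
    forall k, teq1 M0 (d k) r /\ ~ acl (M0 `|` [set d j | j in `I_k]) (d k).
  move=> t; have [[r [er nr]]|none] := pselect (exists r, code r = t /\ ~ acl M0 r); last first.
    by exists (fun=> x0) => r er nr; case: none; exists r.
  have [d hd] := independent_sequence inaccK satM cardM sM0 nr.
  exists d => r' er' _ k; have [h1 h2] := hd k; split=> //.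
  by apply: teq1_trans h1 _; apply: codeP; rewrite er er'.
pose N := M0 `|` range (fun p : set _ * nat => d p.1 p.2).
have sN : small_set N.
  apply: card_lt_setU => //; apply: small_image; apply: small_prod => //.
    apply: small_powerset => //; apply: small_sigma => //[|n]; first exact: small_countable.
    apply: small_prod => //; first exact: small_formula.
    by apply: small_fun => //; exact: small_countable.
  exact: small_countable.
exists (acl N); split; first exact: small_acl.
  by move=> x; apply: acl_trans.
move=> A r fA nr.
have sA : small_set A by exact: finite_card_lt.
(* [r] may be algebraic over [M0], so it is replaced by some [r'] of the same type over [A] that is
   not algebraic over [M0] and [A]. *)
have [||r' r'r nr'] := extension satM cardM (C := M0 `|` A) _ _ nr.
- exact: card_lt_setU.
- by right.
have nr0 : ~ acl M0 r' by move=> h; apply: nr'; apply: acl_mono h => x; left.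
have hk := hd _ _ erefl nr0.
have [k nk] := independent_avoids_finite fA (fun k => (hk k).2).
exists (d (code r') k).
  by apply: acl_incl; right; exists (code r', k).
apply: teq1_trans r'r; apply: (stationary repM0) => //.
by have [] := hk k.
Qed.

(** * From a dense closed set to a lovely pair *)

Lemma eval_substructure (S : structure L) (P : set S) (clP : fun_closed P) n
    (v : 'I_n -> substructure clP) t :
  sval (eval v t) = eval (M := S) (fun i => sval (v i)) t.
Proof.
elim: t => //= f ts IH; congr fun_interp; apply/funext => j; exact: IH.
Qed.

(* Tarski-Vaught: a solution is either algebraic over the parameters or has the same type as
   an element of P. *)
Lemma dense_elementary P : acl P `<=` P -> dense P -> elementary_substructure P.
Proof.
move=> aP dP.
have clP : fun_closed P.
  move=> f v Pv; apply: aP; apply/aclP; exists [set fun_interp M f v]; split=> //.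
  apply/dfn1_formula.
  exists (PFormula (Eq (Var ord0) (App f (fun i => Var (lift ord0 i)))) v) => //.
  apply/seteqP; split=> x; rewrite /solutions /= cons_tuple0;
  by under eq_fun do rewrite cons_tuple_lift.
exists clP => n phi; elim: phi => {n}[n|n s t|n r ts|n p IHp q IHq|n p IH] v //=.
- rewrite -!eval_substructure; split=> [->//|e]; exact: eq_sig_hprop e.
- by under [X in _ <-> rel_interp _ _ X]eq_fun do rewrite -eval_substructure.
- by rewrite IHp IHq.
have eS (x : substructure clP) : (fun i => sval (cons_tuple x v i)) =
    cons_tuple (sval x) (fun i => sval (v i)).
  by have := cons_tuple_comp (fun y : substructure clP => sval y) x v.
split=> h x; last by apply/IH; rewrite eS; exact: h.
apply: contrapT => nx.
pose A := range (fun i => sval (v i)).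
pose E := [set z | ~ sat M p (cons_tuple z (fun i => sval (v i)))].
have dE : dfn1 A E.
  apply: dfn1_not; apply/dfn1_formula.
  by exists (PFormula p (fun i => sval (v i))) => // i; exists i.
have [c Pc Ec] : exists2 c, P c & E c.
  have [ax|nax] := EM (acl A x).
    exists x => //; apply: aP; apply: acl_mono ax => _ [i _ <-]; exact: svalP.
  have [|c Pc t] := dP A x _ nax; first by apply: finite_image; exact: finite_finset.
  by exists c => //; apply/(t _ dE).
apply: Ec; have := h (exist _ c Pc); rewrite IH eS; exact.
Qed.

(** Density gives the coheir condition. Since [Q] is small, the extension condition comes from
    non-algebraic extensions of types over [A] to the union of [A] and [Q]. *)
Lemma small_lovely_pair : exists Q : set M, small_set Q /\ lovely_pair T M Q.
Proof.
have [Q [sQ aQ dQ]] := small_dense_set; exists Q; split=> //.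
have real A q : finite_set A -> complete_type A q -> nonalgebraic q ->
    exists r, ~ acl A r /\ forall c, teq1 A c r -> realizes q c.
  move=> fA cq nq; have [r hr] := satM (card_lt_M cardM (finite_card_lt inaccK fA)) cq.
  have [oq _ compl] := cq; exists r; split=> [[phi [o sr fin]]|c t phi qphi].
    have [/nq//|/hr] := compl _ o; exact.
  apply/(t (solutions phi)); last exact: hr.
  by apply/dfn1_formula; exists phi => //; exact: oq.
split=> //; first exact: dense_elementary.
  by move=> A q fA cq /(real _ _ fA cq)[r [nr hr]]; have [c Qc /hr] := dQ A r fA nr; exists c.
move=> A q fA cq /(real _ _ fA cq)[r [nr hr]].
have [||c /hr ? nc] := extension satM cardM (C := A `|` Q) _ _ nr; last by exists c.
- by apply: card_lt_setU => //; exact: finite_card_lt.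
- by left.
Qed.

End SmallPair.

(** * Back and forth between lovely pairs *)

Section BackAndForth.
Context (L : language).

Lemma geq_card_image (A B : Type) k (f : A -> B) (E : set A) :
  injective f -> geq_card k E -> geq_card k (f @` E).
Proof.
move=> inj; elim: k E => //= k IH E [x [Ex h]]; exists (f x); split; first by exists x.
apply: geq_card_sub (IH _ h) => _ [y [Ey yx] <-]; split; first by exists y.
by move=> /inj.
Qed.

(** By elementarity, the solutions in [P] and those in [S] number at least [k] for the same [k]. A
    solution [x] outside [P] adds one to those in [P], so at least [k] would always give at least
    [k.+1], against finiteness. *)
Lemma elementary_substructure_acl (S : structure L) (P : set S) :
  elementary_substructure P -> acl P `<=` P.
Proof.
move=> [clP H] x [[n phi p] [op sx fin]]; apply: contrapT => nPx.
pose p' (i : 'I_n) : substructure clP := exist P (p i) (op i).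
pose E := solutions (PFormula phi p).
pose G (S : structure L) (w : option 'I_n -> S) := sat S phi (w \o cons_tuple None Some).
have uG : udef G by exact: udef_sat.
pose E' := [set z : substructure clP | G _ (ocons z p')].
have EE k : geq_card k E <-> geq_card k E'.
  have [m [psi [f Hf]]] := udef_geq_card k uG.
  rewrite /E' Hf H -Hf.
  suff -> : [set z | G S (ocons z (fun i => sval (p' i)))] = E by [].
  by apply/seteqP; split=> z; rewrite /G /E /solutions /= cons_tuple_comp.
have E'E : sval @` E' `<=` E `\ x.
  move=> _ [z Gz <-]; split; last by move=> e; apply: nPx; rewrite -e; exact: svalP.
  move: Gz; rewrite /E' /G /= cons_tuple_comp H /E /solutions /=; congr sat.
  exact: (cons_tuple_comp (fun y : substructure clP => sval y) z p').
have all k : geq_card k E.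
  elim: k => // k /EE IH; exists x; split=> //.
  apply: geq_card_sub E'E _; apply: geq_card_image IH.
  by move=> y z; exact: eq_sig_hprop.
by have [k] := finite_ngeq_card fin; apply.
Qed.

(* A formula with the least number of solutions isolates an algebraic type. *)
Lemma elem_algebraic (S1 S2 : structure L) V (a : V -> S1) (b : V -> S2) x :
  elem a b -> acl (range a) x -> exists y, elem (ocons x a) (ocons y b).
Proof.
move=> ab [[n phi p] [op sx fin]].
pose Q k := exists D, [/\ udef D, D S1 (ocons x a) & ~ geq_card k [set z | D S1 (ocons z a)]].
have exQ : exists k, `[< Q k >].
  have /choice[f fp] : forall j : 'I_n, exists v, a v = p j.
    by move=> j; have [v _ e] := op j; exists v.
  have {}fp : p = a \o f by apply/funext => j; rewrite /= fp.
  have [k nk] := finite_ngeq_card fin; exists k; apply/asboolP.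
  exists (fun S w => sat S phi (w \o cons_tuple None (Some \o f))); split.
  - exact: udef_sat.
  - by rewrite cons_tuple_comp; move: sx; rewrite fp.
  - move: nk; rewrite fp; suff -> : solutions (PFormula phi (a \o f)) =
      [set z | sat S1 phi (ocons z a \o cons_tuple None (Some \o f))] by [].
    by apply/seteqP; split=> z; rewrite /= cons_tuple_comp.
have [k /asboolP[D [uD Dx nk]] kmin] := find_ex_minn exQ.
case: k => [|k] in nk kmin *; first by case: nk.
have [y Dy] : exists y, D S2 (ocons y b).
  by apply/(ab (fun S v => exists y, D S (ocons y v)) (udef_ex uD)); exists x.
have {}nk : ~ geq_card k.+1 [set z | D S2 (ocons z b)].
  move=> h; apply: nk; move: h.
  exact: (ab (fun S v => geq_card k.+1 [set z | D S (ocons z v)]) (udef_geq_card _ uD)).2.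
exists y; apply: elem_half => D' uD' D'x; apply: contrapT => nD'y.
(* Adding [D'] to [D] loses the solution [y], so it would lower the minimal number of solutions. *)
have uDD := udef_and uD uD'.
have : ~ geq_card k [set z | D S2 (ocons z b) /\ D' S2 (ocons z b)].
  move=> h; apply: nk; exists y; split=> //; apply: geq_card_sub h => z [Dz D'z].
  by split=> // e; apply: nD'y; rewrite -e.
rewrite -(ab (fun S v => geq_card k [set z | D S (ocons z v) /\ D' S (ocons z v)])
  (udef_geq_card k uDD)) => nk'.
have /kmin : `[< Q k >] by apply/asboolP; exists (fun S v => D S v /\ D' S v).
by rewrite ltnn.
Qed.

(** The type of [x] over [a], carried to parameters in [b] along the map from [a v] to [b v]. *)
Definition transfer (S1 S2 : structure L) V (a : V -> S1) (b : V -> S2) (x : S1) :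
    set (pformula S2) :=
  [set psi | exists f : 'I_(pf_arity psi) -> V, pf_params (p := psi) = b \o f /\
     sat S1 (pf_formula psi) (cons_tuple x (a \o f))].

Section Transfer.
Context (S1 S2 : structure L) (V : Type) (a : V -> S1) (b : V -> S2) (x : S1).
Context (ab : elem a b).

Lemma transfer_complete : complete_type (range b) (transfer a b x).
Proof.
split=> [psi [f [e _]] i|k s hs|[n phi p] op].
- by rewrite e; exists (f i).
- have {}hs : forall i, exists f : 'I_(pf_arity (s i)) -> V, pf_params (p := s i) = b \o f /\
     sat S1 (pf_formula (s i)) (cons_tuple x (a \o f)) by [].
  pose f i := projT1 (cid (hs i)).
  have hf i : pf_params (p := s i) = b \o f i /\
     sat S1 (pf_formula (s i)) (cons_tuple x (a \o f i)) := projT2 (cid (hs i)).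
  pose D (S : structure L) (w : option V -> S) := forall i : 'I_k,
    sat S (pf_formula (s i)) (w \o cons_tuple None (Some \o f i)).
  have uD : udef D by apply: udef_forall_fin => i; exact: udef_sat.
  have [] : exists z, D S2 (ocons z b).
    apply: (ab (udef_ex uD)).1; exists x => i.
    by rewrite cons_tuple_comp; have [] := hf i.
  move=> z hz; exists z => i; have := hz i; rewrite cons_tuple_comp.
  by rewrite /solutions /= (hf i).1.
- have /choice[f fp] : forall j : 'I_n, exists v, b v = p j.
    by move=> j; have [v _ e] := op j; exists v.
  have {}fp : p = b \o f by apply/funext => j; rewrite /= fp.
  by have [h|h] := EM (sat S1 phi (cons_tuple x (a \o f))); [left|right]; exists f.
Qed.

Lemma transfer_nonalgebraic : ~ acl (range a) x -> nonalgebraic (transfer a b x).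
Proof.
move=> nx [n phi p] [f [/= -> sx]] /finite_ngeq_card[k nk]; apply: nx.
pose G (S : structure L) (w : option V -> S) := sat S phi (w \o cons_tuple None (Some \o f)).
have uG : udef G by exact: udef_sat.
have GE (S : structure L) (v : V -> S) :
    [set z | G S (ocons z v)] = solutions (PFormula phi (v \o f)).
  by apply/seteqP; split=> z; rewrite /G /solutions /= cons_tuple_comp.
exists (PFormula phi (a \o f)); split=> //.
rewrite -GE; apply: (@ngeq_card_finite _ k).
by move=> h; apply: nk; rewrite -GE; exact: (ab (udef_geq_card k uG)).1 h.
Qed.

Lemma realizes_transfer y : realizes (transfer a b x) y -> elem (ocons x a) (ocons y b).
Proof.
move=> hy; apply: elem_half => D /udef_formula[n [phi [f H]]] /H sx; apply/H.
by apply: (hy (PFormula phi (b \o f))); exists f.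
Qed.

End Transfer.

Definition independent (S : structure L) (P : set S) V (a : V -> S) (Z : set V) : Prop :=
  forall z, Z z -> ~ acl (P `|` a @` (Z `\ z)) (a z).

Definition spanned (S : structure L) (P : set S) V (a : V -> S) (Z : set V) : Prop :=
  forall v, acl (a @` ([set w | P (a w)] `|` Z)) (a v).

(** The back-and-forth system. Independence over the predicate is not determined by the type of the
    tuple in [L], so it is required on both sides; spanning passes from [a] to [b] by [elem_acl]. *)
Definition good (S1 : structure L) (P1 : set S1) (S2 : structure L) (P2 : set S2) V
    (a : V -> S1) (b : V -> S2) (Z : set V) : Prop :=
  [/\ finite_set [set: V], elem a b, (forall v, P1 (a v) <-> P2 (b v)),
      independent P1 a Z /\ independent P2 b Z & spanned P1 a Z].

Lemma good_sym (S1 : structure L) (P1 : set S1) (S2 : structure L) (P2 : set S2)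
    V (a : V -> S1) (b : V -> S2) Z :
  good P1 P2 a b Z -> good P2 P1 b a Z.
Proof.
move=> [fV ab PP [i1 i2] sp]; split=> //; first exact: elem_sym.
  by move=> v; rewrite PP.
move=> v; have := elem_acl ab (sp v).
by suff -> : [set w | P1 (a w)] = [set w | P2 (b w)] by []; apply/seteqP; split=> w /=; rewrite PP.
Qed.

Lemma independent_acl (S : structure L) (P : set S) V (a : V -> S) (Z : set V) p :
  exchange S -> finite_set [set: V] -> independent P a Z -> P p ->
  acl (a @` ([set w | P (a w)] `|` Z)) p -> acl (a @` [set w | P (a w)]) p.
Proof.
move=> ex fV ind Pp.
have /finite_seqP[s eZ] : @finite_set {classic V} Z by exact: sub_finite_set fV.
have {eZ} [sZ us] : [set` s] `<=` Z /\ Z `<=` [set` undup s].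
  by rewrite eZ; split=> // v /=; rewrite mem_undup.
have {}sZ : [set` undup s] `<=` Z by move=> v /=; rewrite mem_undup => /sZ.
have {us} : acl (a @` ([set w | P (a w)] `|` Z)) p ->
    acl (a @` ([set w | P (a w)] `|` [set` undup s])) p.
  by apply: acl_mono; apply: image_subset => v [|/us]; [left|right].
move=> + h => /(_ h) {h}.
elim: (undup s) (undup_uniq s) sZ => [|z t IH] /= ut sZ.
  by apply: acl_mono => _ [v [Pv|//] <-]; exists v.
move: ut => /andP[zt ut] h.
pose B := a @` ([set w | P (a w)] `|` [set` t]).
have [hB|nB] := EM (acl B p).
  by apply: IH => // v vt; apply: sZ; rewrite /= inE; apply/orP; right.
exfalso; apply: (ind z); first by apply: sZ; rewrite /= inE eqxx.
have : acl (B `|` [set p]) (a z).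
  apply: ex => //; apply: acl_mono h => _ [v [Pv|vt] <-]; first by left; exists v => //; left.
  by move: vt; rewrite /= inE => /predU1P[->|vt]; [right|left; exists v => //; right].
apply: acl_mono => _ [[v [Pv|vt] <-]|->]; [by left| |by left].
right; exists v => //; split; first by apply: sZ; rewrite /= inE; apply/orP; right.
by move=> e; move: zt; rewrite -e vt.
Qed.

Section Extend.
Context (S1 : structure L) (P1 : set S1) (S2 : structure L) (P2 : set S2).
Context (T : set (sentence L)).
Context (lov1 : lovely_pair T S1 P1) (lov2 : lovely_pair T S2 P2).
Context (ex1 : exchange S1) (ex2 : exchange S2).

Lemma acl_P1 : acl P1 `<=` P1.
Proof. by case: lov1 => _ /elementary_substructure_acl. Qed.

Lemma acl_P2 : acl P2 `<=` P2.
Proof. by case: lov2 => _ /elementary_substructure_acl. Qed.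

Lemma finite_option V : finite_set [set: V] -> finite_set [set: option V].
Proof.
move=> fV; apply: (@sub_finite_set _ _ ([set None] `|` Some @` setT)).
  by move=> [v|] _; [right; exists v|left].
by rewrite finite_setU; split; [exact: finite_set1|exact: finite_image].
Qed.

Lemma good_ocons V (a : V -> S1) (b : V -> S2) Z x y :
  good P1 P2 a b Z -> elem (ocons x a) (ocons y b) -> (P1 x <-> P2 y) ->
  P1 x \/ acl (range a) x -> good P1 P2 (ocons x a) (ocons y b) (Some @` Z).
Proof.
move=> [fV ab PP [i1 i2] sp] xy Pxy hx.
have img (S : structure L) (w : S) (c : V -> S) z :
    ocons w c @` ((Some @` Z) `\ Some z) `<=` c @` (Z `\ z).
  by move=> _ [_ [[v Zv <-] vz] <-]; exists v => //; split=> // e; apply: vz; rewrite e.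
have sub : a @` ([set w | P1 (a w)] `|` Z) `<=`
    ocons x a @` ([set w | P1 (ocons x a w)] `|` Some @` Z).
  move=> _ [v [Pv|Zv] <-]; exists (Some v) => //; first by left.
  by right; exists v.
split=> //.
- exact: finite_option.
- by case.
- split=> _ [z Zz <-] h; [apply: (i1 z Zz)|apply: (i2 z Zz)];
    by apply: acl_mono h => w [|/img]; [left|right].
- move=> [v|]; first exact: acl_mono (sp v).
  have [Px|ax] := hx; first by apply: acl_incl; exists None => //; left.
  apply: acl_trans ax => _ [v _ <-]; exact: acl_mono (sp v).
Qed.

(** If [x] is algebraic over the tuple, [independent_acl] makes it algebraic over the part in [P1],
    so its counterpart falls in the closed set [P2]; otherwise density of [P2] supplies one. *)
Lemma good_extend_P V (a : V -> S1) (b : V -> S2) Z x :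
  good P1 P2 a b Z -> P1 x -> exists y, good P1 P2 (ocons x a) (ocons y b) (Some @` Z).
Proof.
move=> gab Px; have [fV ab PP [i1 i2] sp] := gab.
have [y Py xy] : exists2 y, P2 y & elem (ocons x a) (ocons y b).
  have [ax|nax] := EM (acl (range a) x).
    have [y xy] := elem_algebraic ab ax; exists y => //.
    apply: acl_P2.
    have axP : acl (a @` [set w | P1 (a w)]) x.
      apply: (independent_acl ex1 fV i1 Px).
      by apply: acl_trans ax => _ [v _ <-]; exact: sp.
    have e : a @` [set w | P1 (a w)] = ocons x a @` (Some @` [set w | P1 (a w)]).
      by rewrite image_comp.
    have := @elem_acl _ _ _ _ _ _ (Some @` [set w | P1 (a w)]) None xy.
    rewrite -e => /(_ axP); apply: acl_mono => _ [_ [v Pv <-] <-].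
    exact/PP.
  have [_ _ dens _] := lov2.
  have [|y Py hy] := dens _ _ _ (transfer_complete x ab)
    (transfer_nonalgebraic ab nax); last by exists y => //; exact: realizes_transfer.
  exact: finite_image.
by exists y; apply: good_ocons => //; left.
Qed.

(** The point is that [x] and [y] agree on the predicate: by [independent_acl], a member of the
    predicate algebraic over the tuple is algebraic over the part of the tuple inside it, and [elem]
    preserves this. *)
Lemma good_extend_acl V (a : V -> S1) (b : V -> S2) Z x :
  good P1 P2 a b Z -> acl (range a) x ->
  exists y, good P1 P2 (ocons x a) (ocons y b) (Some @` Z).
Proof.
move=> gab ax; have [fV ab PP [i1 i2] sp] := gab.
have [y xy] := elem_algebraic ab ax; exists y; apply: good_ocons => //; last by right.
have img (S : structure L) (c : V -> S) (w : S) (X : set V) :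
  ocons w c @` (Some @` X) = c @` X by rewrite image_comp.
have spx : acl (a @` ([set w | P1 (a w)] `|` Z)) x.
  by apply: acl_trans ax => _ [v _ <-]; exact: sp.
have [_ _ _ _ sp2] := good_sym gab.
have spy : acl (b @` ([set w | P2 (b w)] `|` Z)) y.
  apply: (@acl_trans _ _ _ (range b)) => [_ [v _ <-]|]; first exact: sp2.
  have := @elem_acl _ _ _ _ _ _ (Some @` setT) None xy.
  by rewrite !img; exact.
split=> Pz.
  have := independent_acl ex1 fV i1 Pz spx => axP; apply: acl_P2.
  have := @elem_acl _ _ _ _ _ _ (Some @` [set w | P1 (a w)]) None xy.
  by rewrite !img => /(_ axP); apply: acl_mono => _ [v Pv <-]; exact/PP.
have := independent_acl ex2 fV i2 Pz spy => ayP; apply: acl_P1.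
have := @elem_acl _ _ _ _ _ _ (Some @` [set w | P2 (b w)]) None (elem_sym xy).
by rewrite !img => /(_ ayP); apply: acl_mono => _ [v Pv <-]; exact/PP.
Qed.

(** The extension condition supplies [y], and the new element joins [Z]; exchange keeps the old
    members independent. *)
Lemma good_extend_generic V (a : V -> S1) (b : V -> S2) Z x :
  good P1 P2 a b Z -> ~ acl (range a `|` P1) x ->
  exists y, good P1 P2 (ocons x a) (ocons y b) (None |` Some @` Z).
Proof.
move=> gab nx; have [fV ab PP [i1 i2] sp] := gab.
have nax : ~ acl (range a) x by move=> h; apply: nx; apply: acl_mono h => z; left.
have [_ _ _ ext] := lov2.
have [|y hy ny] := ext _ _ _ (transfer_complete x ab)
  (transfer_nonalgebraic ab nax); first exact: finite_image.
have xy : elem (ocons x a) (ocons y b) := realizes_transfer hy.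
have ind (S : structure L) (P : set S) (c : V -> S) (w : S) : exchange S ->
    ~ acl (range c `|` P) w -> independent P c Z ->
    independent P (ocons w c) (None |` Some @` Z).
  move=> ex nw ic _ [->|[z Zz <-]] /= h.
    apply: nw; apply: acl_mono h => u [Pu|[_ [[->|[v Zv <-]] nN] <-]]; first by right.
      by case: nN.
    by left; exists v.
  pose B := P `|` c @` (Z `\ z).
  have hw : acl (B `|` [set w]) (c z).
    apply: acl_mono h => u [Pu|[_ [[->|[v Zv <-]] nN] <-]]; first by left; left.
      by right.
    left; right; exists v => //; split=> // e; apply: nN; by rewrite e.
  have := ex _ _ _ hw (ic z Zz) => hz; apply: nw; apply: acl_mono hz.
  by move=> u [[Pu|[v _ <-]]|->]; [right|left; exists v|left; exists z].
exists y; split=> //; first exact: finite_option.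
- move=> [v|] /=; first exact: PP.
  split=> Pz; exfalso; [apply: nx|apply: ny]; apply: acl_incl; first by right.
  by right.
- by split; apply: ind.
- move=> [v|]; last by apply: acl_incl; exists None => //; right; left.
  apply: acl_mono (sp v) => _ [u [Pu|Zu] <-]; exists (Some u) => //; first by left.
  by right; right; exists u.
Qed.

Definition good_over V (a : V -> S1) (b : V -> S2) (X : set S1) : Prop :=
  exists W (a' : W -> S1) (b' : W -> S2) Z (f : V -> W),
    [/\ good P1 P2 a' b' Z, a = a' \o f, b = b' \o f & X `<=` range a'].

(** Unless [x] is generic over the tuple and [P1], it is algebraic over the tuple and finitely many
    elements of [P1], which are added first. *)
Lemma good_extend V (a : V -> S1) (b : V -> S2) Z x :
  good P1 P2 a b Z -> good_over a b [set x].
Proof.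
move=> gab.
have stop W (a' : W -> S1) (b' : W -> S2) Z' (f : V -> W) y :
    good P1 P2 (ocons x a') (ocons y b') Z' -> a = a' \o f -> b = b' \o f ->
    good_over a b [set x].
  move=> g -> ->; exists (option W), (ocons x a'), (ocons y b'), Z', (Some \o f).
  by split=> // _ ->; exists None.
have [/acl_finite_left[A [fA AP ax]]|nx] := EM (acl (P1 `|` range a) x); last first.
  have [|y gy] := @good_extend_generic _ _ _ _ x gab; first by rewrite setUC.
  exact: (@stop _ _ _ _ id y gy).
have /finite_seqP[s eA] : @finite_set {classic S1} A := fA.
have [W [a' [b' [Z' [f [g ea eb sA]]]]]] : good_over a b A.
  rewrite {}eA in AP *; clear fA ax.
  elim: s AP => [|p s IH] AP; first by exists V, a, b, Z, id; split.
  have [|W [a' [b' [Z' [f [g ea eb sA]]]]]] := IH.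
    by move=> z zs; apply: AP; rewrite /= inE; apply/orP; right.
  have [|y gy] := @good_extend_P _ _ _ _ p g; first by apply: AP; rewrite /= inE eqxx.
  exists (option W), (ocons p a'), (ocons y b'), (Some @` Z'), (Some \o f); split=> //.
  move=> z; rewrite /= inE => /predU1P[->|/sA[w _ <-]]; first by exists None.
  by exists (Some w).
have [|y gy] := @good_extend_acl _ _ _ _ x g; last exact: stop gy ea eb.
apply: acl_mono ax => z [/sA//|[v _ <-]]; exists (f v) => //.
by rewrite ea.
Qed.

End Extend.

(** * Preservation of formulas with the predicate *)

Fixpoint reduct_term n (t : term (pair_language L) n) : term L n :=
  match t with
  | Var i => Var i
  | App f ts => @App L n f (fun j => reduct_term (ts j))
  end.

Lemma eval_expand (S : structure L) (P : set S) n (v : 'I_n -> S) t :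
  eval (M := expand S P) v t = eval v (reduct_term t).
Proof. by elim: t => //= f ts IH; congr fun_interp; apply/funext => j. Qed.

Lemma good_sat T n (phi : formula (pair_language L) n) (S1 : structure L) (P1 : set S1)
    (S2 : structure L) (P2 : set S2) V (a : V -> S1) (b : V -> S2) Z (f : 'I_n -> V) :
  lovely_pair T S1 P1 -> lovely_pair T S2 P2 -> exchange S1 -> exchange S2 ->
  good P1 P2 a b Z -> sat (expand S1 P1) phi (a \o f) -> sat (expand S2 P2) phi (b \o f).
Proof.
elim: phi S1 P1 S2 P2 V a b Z f => {n}[n|n s t|n r ts|n p IHp q IHq|n p IH]
  S1 P1 S2 P2 V a b Z f lov1 lov2 ex1 ex2 g //=.
- rewrite !eval_expand; have [_ ab _ _ _] := g.
  exact: (ab _ (udef_sat (Eq (reduct_term s) (reduct_term t)) f)).1.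
- case: r ts => [r|] ts /=.
    under [X in rel_interp _ _ X -> _]eq_fun do rewrite eval_expand.
    under [X in _ -> rel_interp _ _ X]eq_fun do rewrite eval_expand.
    have [_ ab _ _ _] := g.
    exact: (ab _ (udef_sat (Rel r (fun j => reduct_term (ts j))) f)).1.
  rewrite !eval_expand; set t := reduct_term _.
  (* The value of the term need not belong to the tuple, so the tuple is first extended to contain
     it. *)
  have [W [a' [b' [Z' [h [g' ea eb sx]]]]]] := good_extend lov1 lov2 ex1 ex2 (eval (a \o f) t) g.
  have [w _ ew] := sx _ erefl.
  have [_ ab' PP _ _] := g'.
  have : eval (b \o f) t = b' w.
    pose phi : formula L n.+1 := Eq (Var ord0) (ren_term (lift ord0) t).
    have phiE (S : structure L) (c : W -> S) :
        sat S phi (c \o cons_tuple w (h \o f)) <-> c w = eval (c \o h \o f) t.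
      rewrite cons_tuple_comp /= cons_tuple0 eval_ren.
      by suff -> : cons_tuple (c w) (c \o (h \o f)) \o lift ord0 = c \o h \o f by [];
        apply/funext => i /=; rewrite cons_tuple_lift.
    rewrite eb; apply/esym/phiE.
    by apply: (ab' _ (udef_sat phi _)).1; apply/phiE; rewrite ew ea.
  by move=> ->; rewrite -ew => /PP.
- move=> hpq hp; apply: (IHq _ _ _ _ _ _ _ _ _ lov1 lov2 ex1 ex2 g); apply: hpq.
  exact: (IHp _ _ _ _ _ _ _ _ _ lov2 lov1 ex2 ex1 (good_sym g)).
- move=> hx y.
  (* The challenge [y] lies in [S2], so the extension is made from right to left. *)
  have [W [b' [a' [Z' [h [g' eb ea sy]]]]]] := good_extend lov2 lov1 ex2 ex1 y (good_sym g).
  have [w _ ew] := sy _ erefl.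
  have := IH _ _ _ _ _ _ _ _ (cons_tuple w (h \o f)) lov1 lov2 ex1 ex2 (good_sym g').
  by rewrite !cons_tuple_comp ew eb; apply; have := hx (a' w); rewrite ea.
Qed.

End BackAndForth.

(** The empty tuple starts the back and forth: it is elementary because [T] is complete. *)
Lemma lovely_pairs_equiv L (T : set (sentence L)) (S1 S2 : structure L) (P1 : set S1) (P2 : set S2)
    phi : complete_theory T -> lovely_pair T S1 P1 -> lovely_pair T S2 P2 ->
  exchange S1 -> exchange S2 -> holds (expand S1 P1) phi -> holds (expand S2 P2) phi.
Proof.
move=> complT lov1 lov2 ex1 ex2.
have g : good P1 P2 (@no_tuple S1) (@no_tuple S2) set0.
  split; [exact: finite_finset| |by case|by split|by case].
  apply: elem_half => D [n [psi [f H]]]; rewrite !H -!sat_ren => h.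
  by apply: (complete_models complT) h; [case: lov1|case: lov2].
have := @good_sat _ _ _ phi _ _ _ _ _ _ _ _ no_tuple lov1 lov2 ex1 ex2 g.
by rewrite !(no_tupleE (_ \o _)).
Qed.

(** * Size of the predicate, and the conclusion *)

Lemma saturated_pair_predicate K L (M : structure L) (P : set M) :
  strongly_inaccessible K -> [set: M] #= [set: K] -> saturated (expand M P) ->
  infinite_set P -> ~ card_lt P [set: K].
Proof.
move=> inaccK cardM satMP infP sP.
have dP : @dfn1 _ (expand M P) P P.
  apply/dfn1_formula; exists (@PFormula _ (expand M P) 0
    (@Rel (pair_language L) 1 None (fun=> Var ord0)) no_tuple); first by case.
  by apply/seteqP; split=> x; rewrite /solutions /= cons_tuple0.
(* The family consists of the cofinite subsets of [P] definable over [P]; a common element lies in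
   [P] and differs from every element of [P]. *)
have [|X [dX [Y fY eX]]|X X' [dX [Y fY eX]] [dX' [Y' fY' eX']]|x hx] :=
  @saturated_dfn1 K _ (expand M P) satMP cardM P
    [set X | @dfn1 _ (expand M P) P X /\ exists2 Y, finite_set Y & X = P `\` Y] sP.
- by exists P; split=> //; exists set0; rewrite ?setD0.
- by split=> //; rewrite eX; exact/infinite_setN0/infinite_setD.
- exists (X `&` X') => //; split; first exact: dfn1_and.
  exists (Y `|` Y'); first by rewrite finite_setU.
  by rewrite eX eX' setDUr.
have Px : P x by apply: (hx P); split=> //; exists set0; rewrite ?setD0.
suff [_ +] : (P `\` [set x]) x by apply.
apply: hx; split; last by exists [set x].
by apply: dfn1_and => //; apply: dfn1_not; exact: dfn1_point.
Qed.

(** If [P] were finite, the coheir condition with [A = P] would realize the type of [r] over [P]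
    inside [P], whereas this type excludes every element of [P]. *)
Lemma lovely_pair_infinite L (T : set (sentence L)) (M : structure L) (P : set M) r :
  lovely_pair T M P -> ~ acl P r -> infinite_set P.
Proof.
move=> [_ _ dens _] nr fP.
have [|a Pa ha] := dens P _ fP (type_of_complete P r).
  by move=> phi [o sr] fin; apply: nr; exists phi.
pose psi : pformula M := PFormula (Eq (Var ord0) (Var (lift ord0 ord0))) (fun _ : 'I_1 => a).
have psiE y : solutions psi y <-> y = a.
  by rewrite /solutions /= cons_tuple0 cons_tuple_lift.
have /ha : type_of P r (pneg psi).
  by split=> [i //|/psiE e]; apply: nr; rewrite e; exact: acl_incl.
by apply; apply/psiE.
Qed.

Theorem proposition5p8 (K : Type) (L : language) (T : set (sentence L))
    (M : structure L) (P : set M) :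
  strongly_inaccessible K ->
  card_lt [set: symbols L]%classic [set: K]%classic ->
  complete_theory T ->
  (exists N : structure L, models T N /\ infinite_set [set: N]%classic) ->
  U_rank_one K T ->
  monster K T M ->
  monster K (lovely_theory T) (expand M P) ->
  e_class M P <> o_class M P.
Proof.
move=> inaccK smallL complT _ [stabT rankT] monM [modP _ satP] e_eq_o.
have [modM cardM satM] := monM; have rankM := rankT M monM.
have exM := rank_one_exchange inaccK satM cardM rankM.
have [Q [sQ lovQ]] := small_lovely_pair inaccK smallL satM cardM rankM stabT modM.
(* By back and forth, a sentence true of [M] with [Q] holds in every lovely pair, so it belongs to
   the theory of which [M] with [P] is a model. *)
have thQ phi : holds (expand M Q) phi -> holds (expand M P) phi.
  move=> hQ; apply: modP => N R lovR.
  apply: (lovely_pairs_equiv complT lovQ lovR exM _ hQ).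
  by apply: (exchange_models complT inaccK satM cardM modM exM); case: lovR.
have : e_class M P Q.
  move=> phi; split; last exact: thQ.
  by move=> hP; apply: contrapT => nQ; exact: (thQ (Neg phi) nQ hP).
(* An isomorphism carries [P] onto [Q], so [P] is small, against the saturation of the pair. *)
rewrite e_eq_o => -[f [[f' fK f'K] _ /(_ None) frel]].
have PQ x : P x <-> Q (f x) by exact: (frel (fun=> x)).
have eQ : Q = f @` P.
  apply/seteqP; split=> y; last by move=> [x Px <-]; exact/PQ.
  by move=> Qy; exists (f' y) => //; apply/PQ; rewrite f'K.
have eP : P = f' @` Q.
  by rewrite eQ image_comp; apply/seteqP; split=> x; [exists x|move=> [y Py <-]]; rewrite //= fK.
apply: (saturated_pair_predicate inaccK cardM satP); last first.
  by rewrite eP; apply: card_lt_le sQ; exact: card_image_le.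
have infM : infinite_set [set: M].
  have [[natK _] _ _] := inaccK; move: cardM; rewrite card_eq_le => /andP[_ KM].
  by apply/infiniteP; exact: card_le_trans natK KM.
(* As [Q] is small, some [r] is not algebraic over it; this makes [Q], and with it [P], infinite. *)
have [||||r [nr _]] := extension_dfn1 satM cardM (A := Q) (C := Q) (F := [set setT]) sQ.
- by [].
- by exists setT.
- by move=> E ->; split=> //; exact: dfn1_top.
- by move=> E E' -> ->; exists setT.
move=> fP; apply: (lovely_pair_infinite lovQ nr); rewrite eQ.
exact: finite_image.
Qed.
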